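(* Let $1\le p\le\infty$. Then: (a) For every function $\varphi:\mathbb{R}_+\to\mathbb{R}_+$ with $\varphi(r)\to\infty$ as $r\to\infty$ there is an entire function $f$ that is irregular for the differentiation operator $D$ and satisfies $$M_p(f,r)\le \varphi(r)\,\frac{e^r}{\sqrt r}\quad\text{for all sufficiently large } r>0.$$ (b) There is no entire function $f$ that is irregular for $D$ and satisfies, for some constant $C>0$, $$M_p(f,r)\le C\,\frac{e^r}{\sqrt r}\quad\text{for all } r>0.$$
   Context: $\mathbb{N}$ is the set of positive integers, $\mathbb{R}_+$ denotes the positive real numbers. $H(\mathbb{C})$ is the Fréchet space of entire functions with the topology of uniform convergence on compact sets, and $D:H(\mathbb{C})\to H(\mathbb{C})$, $Df=f'$. For $m\in\mathbb{N}$, $\overline{B(0,m)}=\{z\in\mathbb{C}:|z|\le m\}$ and $\|g\|_{\infty,\overline{B(0,m)}}=\sup_{|z|\le m}|g(z)|$. An entire function $f$ is irregular for $D$ if there are $m\in\mathbb{N}$ and (strictly) increasing sequences $(n_k)$, $(j_k)$ of positive integers such that $\lim_{k\to\infty}D^{n_k}f=0$ in $H(\mathbb{C})$ and $\lim_{k\to\infty}\|D^{j_k}f\|_{\infty,\overline{B(0,m)}}=\infty$. For an entire function $f$ and $r>0$: $M_p(f,r)=\left(\frac1{2\pi}\int_0^{2\pi}|f(re^{it})|^p\,dt\right)^{1/p}$ if $1\le p<\infty$, and $M_\infty(f,r)=\sup_{|z|=r}|f(z)|$. *)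

(* Defs.v *)
From Stdlib Require Import Reals List.
From Coquelicot Require Import Coquelicot.
Open Scope R_scope.

Definition entire (f : C -> C) : Prop :=
  forall z : C, @ex_derive C_AbsRing C_NormedModule f z.

(* [C_derive] is total; by [C_derive_correct] it is the complex derivative
   wherever the function is complex differentiable, hence everywhere for an
   entire function and all its iterated derivatives. *)
Definition D_iter (n : nat) (f : C -> C) : C -> C := Nat.iter n C_derive f.

Definition compact_set (K : C -> Prop) : Prop :=
  forall U : (C -> Prop) -> Prop,
    (forall V, U V -> @open C_UniformSpace V) ->
    (forall z, K z -> exists V, U V /\ V z) ->
    exists l : list (C -> Prop),
      (forall V, In V l -> U V) /\
      (forall z, K z -> exists V, In V l /\ V z).

(* Convergence of a sequence in H(C). *)
Definition cvg_H (g : nat -> C -> C) (g0 : C -> C) : Prop :=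
  forall K : C -> Prop, compact_set K ->
  forall eps : R, 0 < eps ->
    eventually (fun k => forall z, K z -> Cmod (g k z - g0 z) < eps).

(* The supremum of |g| over E.  It is only used for g continuous and E a
   nonempty compact set, where the extended supremum is finite and [real] loses
   nothing. *)
Definition sup_mod (E : C -> Prop) (g : C -> C) : R :=
  real (Lub_Rbar (fun x => exists z, E z /\ x = Cmod (g z))).

Definition closed_disc (m : nat) (z : C) : Prop := Cmod z <= INR m.

Definition incr_pos_seq (u : nat -> nat) : Prop :=
  (forall k, (0 < u k)%nat) /\ (forall k, (u k < u (S k))%nat).

(* Irregularity for the differentiation operator; meant for entire f. *)
Definition irregular (f : C -> C) : Prop :=
  exists (m : nat) (n j : nat -> nat),
    (0 < m)%nat /\ incr_pos_seq n /\ incr_pos_seq j /\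
    cvg_H (fun k => D_iter (n k) f) (fun _ => RtoC 0) /\
    is_lim_seq (fun k => sup_mod (closed_disc m) (D_iter (j k) f)) p_infty.

(* Real power on [0, +oo) with 0 ^ y = 0, for y > 0: the library's [Rpower 0 y]
   is 1, which would be wrong at the zeros of f. *)
Definition rpow (x y : R) : R := if Req_EM_T x 0 then 0 else Rpower x y.

(* The p-mean M_p(f, r), for 1 <= p <= +oo; the value at m_infty is a dummy. *)
Definition Mp (p : Rbar) (f : C -> C) (r : R) : R :=
  match p with
  | Finite q =>
      rpow (/ (2 * PI) *
            RInt (fun t => rpow (Cmod (f (RtoC r * (cos t, sin t))%C)) q)
                 0 (2 * PI))
           (/ q)
  | p_infty => sup_mod (fun z => Cmod z = r) f
  | m_infty => 0
  end.

(* Main.v *)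
(** Part (a) is witnessed by a lacunary series [f = sum_k k z^(N_k) / N_k!].
    Its [N_k]-th derivative at [0] is [k], while its [(N_k + 1)]-st derivative
    is small on compact sets when [N_(k+1)] is large enough compared with
    [N_k].  By Stirling's formula each [r^N / N!] is at most [e^r / sqrt r], and
    it is negligible unless [r] is comparable with [N], so for [N_k] sparse
    enough only the terms with [1 + ... + k <= phi r] matter.

    For part (b), Cauchy's estimate on the circle of radius [n] and Stirling's
    formula show that the growth condition bounds all derivatives of [f] at [0]
    by a common constant [K]; by Taylor's formula they are then bounded by
    [K e^m] on the disc of radius [m].  Cauchy's formula comes from Goursat's
    theorem for the rectangle [x1 <= Re w <= x2, 0 <= Im w <= 2 PI] and the
    function [f (a + e^w) e^(-n w)]: the horizontal sides cancel by periodicity,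
    so the integral over a circle around [a] does not depend on the radius, and
    for [n = 1] it tends to [2 PI f'(a)] as the radius shrinks.  The resulting
    formula for [f'] shows that [f'] is continuous, then entire; integration by
    parts gives the higher derivatives. *)

Require Import Defs.
From Stdlib Require Import Reals List.
From Coquelicot Require Import Coquelicot.
From Stdlib Require Import Lra Lia Factorial ClassicalEpsilon
  FunctionalExtensionality.
Open Scope R_scope.

(** * Complex differentiability in epsilon-delta form *)

(** All [p] are treated at once: [Mp] is at most the supremum over the circle, and a bound [B] on it
    bounds the mean of |f| by [2 * B]. So part (a) only has to estimate a supremum, and part (b)
    only uses the mean of |f|, which is what Cauchy's formula sees. The rate [exp r / sqrt r] is
    critical because r^(n + 1/2) e^(-r) / n! is bounded in both variables; this takes a lower
    Stirling bound for (a), while (b) takes an upper one. In (a), [phi] may grow arbitrarily slowly,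
    so the exponents are chosen after [phi]: the coefficient k may become visible only at radii
    where [phi] already exceeds 1 + ... + k. In (b), passing from derivatives at 0 to a disc by
    Taylor's formula requires a remainder that vanishes, hence some a priori bound on all
    derivatives over the disc; Cauchy's estimate on a larger disc supplies it. Since [entire] says
    nothing about continuity of the derivative, the vanishing of rectangle integrals has to come
    from subdivision. *)

Definition cder (f : C -> C) (z l : C) : Prop :=
  forall eps, 0 < eps -> exists delta, 0 < delta /\
    forall h, Cmod h < delta ->
      Cmod (f (z + h) - f z - l * h)%C <= eps * Cmod h.

Definition ccont (f : C -> C) (z : C) : Prop :=
  forall eps, 0 < eps -> exists delta, 0 < delta /\
    forall h, Cmod h < delta -> Cmod (f (z + h) - f z)%C < eps.

Lemma cder_is_derive (f : C -> C) (z l : C) :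
  cder f z l <-> @is_derive C_AbsRing C_NormedModule f z l.
Proof.
split.
- intros H; split.
  + apply is_linear_scal_l.
  + intros x Hx eps.
    assert (Ex : z = x).
    { apply (@is_filter_lim_locally_unique C_AbsRing
        (AbsRing_NormedModule C_AbsRing)); exact Hx. }
    subst x.
    destruct (H eps (cond_pos eps)) as [d [Hd H1]].
    exists (mkposreal d Hd); intros y Hy.
    change (Cmod (y - z)%C < d) in Hy.
    change (Cmod (f y - f z - (y - z) * l)%C <= eps * Cmod (y - z)%C).
    specialize (H1 _ Hy).
    assert (E : forall u v : C, (u + (v - u))%C = v) by (intros; ring).
    rewrite E in H1; rewrite (Cmult_comm (y - z) l); exact H1.
- intros [_ H] eps He.
  destruct (H z (fun P HP => HP) (mkposreal eps He)) as [d Hd].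
  exists d; split; [apply cond_pos|]; intros h Hh.
  specialize (Hd (z + h)%C).
  change (Cmod (z + h - z)%C < d ->
    Cmod (f (z + h)%C - f z - (z + h - z) * l)%C <= eps * Cmod (z + h - z)%C)
    in Hd.
  replace (z + h - z)%C with h in Hd by ring.
  replace (l * h)%C with (h * l)%C by ring. auto.
Qed.

(* [C_NormedModule] and [C_AbsRing] seen as a module over itself carry the same
   norm but different uniform structures. *)
Lemma cder_is_derive_AbsRing (f : C -> C) (z l : C) :
  cder f z l <-> @is_derive C_AbsRing (AbsRing_NormedModule C_AbsRing) f z l.
Proof.
rewrite cder_is_derive.
split; intros [_ H]; (split; [apply is_linear_scal_l|exact H]).
Qed.

Lemma cder_C_derive (f : C -> C) (z l : C) : cder f z l -> C_derive f z = l.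
Proof. intros H; apply is_C_derive_unique, cder_is_derive, H. Qed.

Lemma cder_ex (f : C -> C) (z l : C) :
  cder f z l -> @ex_derive C_AbsRing C_NormedModule f z.
Proof. intros H; exists l; apply cder_is_derive, H. Qed.

Lemma entire_cder (f : C -> C) (z : C) : entire f -> cder f z (C_derive f z).
Proof. intros H; apply cder_is_derive, C_derive_correct; [exact z|apply H]. Qed.

Lemma cder_const (c z : C) : cder (fun _ => c) z 0.
Proof.
intros eps He; exists 1; split; [lra|]; intros h _.
replace (c - c - 0 * h)%C with (RtoC 0) by ring.
rewrite Cmod_0; apply Rmult_le_pos; [lra|apply Cmod_ge_0].
Qed.

Lemma cder_id (z : C) : cder (fun w => w) z 1.
Proof.
intros eps He; exists 1; split; [lra|]; intros h _.
replace (z + h - z - 1 * h)%C with (RtoC 0) by ring.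
rewrite Cmod_0; apply Rmult_le_pos; [lra|apply Cmod_ge_0].
Qed.

Lemma cder_plus (f g : C -> C) (z a b : C) :
  cder f z a -> cder g z b -> cder (fun w => f w + g w)%C z (a + b)%C.
Proof.
rewrite !cder_is_derive; intros Hf Hg.
exact (@is_derive_plus C_AbsRing C_NormedModule f g z a b Hf Hg).
Qed.

Lemma cder_mult (f g : C -> C) (z a b : C) :
  cder f z a -> cder g z b ->
  cder (fun w => f w * g w)%C z (a * g z + f z * b)%C.
Proof.
rewrite !cder_is_derive_AbsRing; intros Hf Hg.
exact (@is_derive_mult C_AbsRing f g z a b Hf Hg Cmult_comm).
Qed.

Lemma cder_comp (f g : C -> C) (z a b : C) :
  cder f (g z) a -> cder g z b -> cder (fun w => f (g w)) z (a * b)%C.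
Proof.
rewrite !cder_is_derive_AbsRing; intros Hf Hg; rewrite Cmult_comm.
exact (@is_derive_comp C_AbsRing (AbsRing_NormedModule C_AbsRing)
  f g z a b Hf Hg).
Qed.

Lemma cder_eq (f : C -> C) (z a b : C) : cder f z a -> a = b -> cder f z b.
Proof. now intros H <-. Qed.

Lemma cder_affine (c d z : C) : cder (fun w => c + d * w)%C z d.
Proof.
eapply cder_eq.
- apply cder_plus; [apply cder_const|].
  apply cder_mult; [apply cder_const|apply cder_id].
- simpl; ring.
Qed.

Lemma cder_ccont (f : C -> C) (z l : C) : cder f z l -> ccont f z.
Proof.
intros H eps He; destruct (H 1 Rlt_0_1) as [d [Hd Hf]].
assert (Hl := Cmod_ge_0 l).
assert (Hp : 0 < eps / (2 + Cmod l)) by (apply Rdiv_lt_0_compat; lra).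
exists (Rmin d (eps / (2 + Cmod l))); split.
- now apply Rmin_pos.
- intros h Hh.
  assert (H1 := Rmin_l d (eps / (2 + Cmod l))).
  assert (H2 := Rmin_r d (eps / (2 + Cmod l))).
  specialize (Hf h ltac:(lra)).
  replace (f (z + h) - f z)%C with ((f (z + h) - f z - l * h) + l * h)%C by ring.
  eapply Rle_lt_trans; [apply Cmod_triangle|]; rewrite Cmod_mult.
  assert (Hh' : Cmod h * (2 + Cmod l) < eps).
  { apply Rlt_le_trans with (eps / (2 + Cmod l) * (2 + Cmod l)).
    - apply Rmult_lt_compat_r; lra.
    - right; field; lra. }
  assert (H3 := Cmod_ge_0 h); nra.
Qed.

Lemma entire_ccont (f : C -> C) (z : C) : entire f -> ccont f z.
Proof. intros H; eapply cder_ccont, entire_cder, H. Qed.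

Lemma ccont_const (c z : C) : ccont (fun _ => c) z.
Proof. eapply cder_ccont, cder_const. Qed.

Lemma ccont_comp (f g : C -> C) (z : C) :
  ccont f (g z) -> ccont g z -> ccont (fun w => f (g w)) z.
Proof.
intros Hf Hg eps He; destruct (Hf eps He) as [d [Hd H1]].
destruct (Hg d Hd) as [d' [Hd' H2]]; exists d'; split; trivial.
intros h Hh; specialize (H1 _ (H2 h Hh)).
now replace (g z + (g (z + h) - g z))%C with (g (z + h)%C) in H1 by ring.
Qed.

Lemma ccont_plus (f g : C -> C) (z : C) :
  ccont f z -> ccont g z -> ccont (fun w => f w + g w)%C z.
Proof.
intros Hf Hg eps He; destruct (Hf (eps/2) ltac:(lra)) as [d [Hd H1]].
destruct (Hg (eps/2) ltac:(lra)) as [d' [Hd' H2]].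
exists (Rmin d d'); split; [now apply Rmin_pos|]; intros h Hh.
assert (E1 := Rmin_l d d'); assert (E2 := Rmin_r d d').
specialize (H1 h ltac:(lra)); specialize (H2 h ltac:(lra)).
replace (f (z + h) + g (z + h) - (f z + g z))%C
  with ((f (z + h) - f z) + (g (z + h) - g z))%C by ring.
eapply Rle_lt_trans; [apply Cmod_triangle|]; lra.
Qed.

Lemma ccont_mult (f g : C -> C) (z : C) :
  ccont f z -> ccont g z -> ccont (fun w => f w * g w)%C z.
Proof.
intros Hf Hg eps He.
assert (Hf0 := Cmod_ge_0 (f z)); assert (Hg0 := Cmod_ge_0 (g z)).
set (k := Rmin 1 (eps / (2 + Cmod (f z) + Cmod (g z)))).
assert (Hk : 0 < k) by (apply Rmin_pos; [lra|apply Rdiv_lt_0_compat; lra]).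
assert (Hk1 : k <= 1) by apply Rmin_l.
assert (Hk2 : k * (2 + Cmod (f z) + Cmod (g z)) <= eps).
{ apply Rle_trans with
    (eps / (2 + Cmod (f z) + Cmod (g z)) * (2 + Cmod (f z) + Cmod (g z))).
  - apply Rmult_le_compat_r; [lra|apply Rmin_r].
  - right; field; lra. }
destruct (Hf k Hk) as [d [Hd H1]].
destruct (Hg k Hk) as [d' [Hd' H2]].
exists (Rmin d d'); split; [now apply Rmin_pos|]; intros h Hh.
assert (E1 := Rmin_l d d'); assert (E2 := Rmin_r d d').
specialize (H1 h ltac:(lra)); specialize (H2 h ltac:(lra)).
replace (f (z + h) * g (z + h) - (f z * g z))%C
  with ((f (z + h) - f z) * (g (z + h) - g z) + (f (z + h) - f z) * g z
        + f z * (g (z + h) - g z))%C by ring.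
eapply Rle_lt_trans; [eapply Rle_trans; [apply Cmod_triangle|];
  apply Rplus_le_compat_r, Cmod_triangle|].
rewrite !Cmod_mult.
assert (P1 := Cmod_ge_0 (f (z + h) - f z)%C).
assert (P2 := Cmod_ge_0 (g (z + h) - g z)%C).
nra.
Qed.

(** * Integrals of complex-valued functions of a real variable *)

(** The integrand is a function of a complex variable evaluated at real points, so that its
    continuity and derivatives are those of [ccont] and [cder] and no separate calculus for
    functions of a real variable is needed. *)
Definition cint (F : C -> C) (a b : R) : C :=
  @RInt C_R_CompleteNormedModule (fun t => F (RtoC t)) a b.

Definition conR (F : C -> C) : Prop := forall t : R, ccont F (RtoC t).

Lemma conR_continuous (F : C -> C) (t : R) :
  conR F -> @continuous R_UniformSpace C_UniformSpace (fun t => F (RtoC t)) t.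
Proof.
intros H; apply filterlim_locally; intros eps.
destruct (H t eps (cond_pos eps)) as [d [Hd Hf]].
exists (mkposreal d Hd); intros s Hs.
change (Rabs (s - t) < d) in Hs.
apply C_NormedModule_mixin_compat1.
specialize (Hf (RtoC (s - t))); rewrite Cmod_R in Hf.
replace (RtoC t + RtoC (s - t))%C with (RtoC s) in Hf
  by (rewrite RtoC_minus; ring).
exact (Hf Hs).
Qed.

Lemma is_cint (F : C -> C) (a b : R) :
  conR F -> @is_RInt C_R_NormedModule (fun t => F (RtoC t)) a b (cint F a b).
Proof.
intros H; apply (@RInt_correct C_R_CompleteNormedModule).
apply ex_RInt_continuous; intros t _; now apply conR_continuous.
Qed.

Lemma cint_unique (F : C -> C) (a b : R) (l : C) :
  @is_RInt C_R_NormedModule (fun t => F (RtoC t)) a b l -> cint F a b = l.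
Proof. exact (@is_RInt_unique C_R_CompleteNormedModule _ _ _ _). Qed.

Lemma cint_ext (F G : C -> C) (a b : R) :
  (forall t : R, F (RtoC t) = G (RtoC t)) -> cint F a b = cint G a b.
Proof.
intros H; apply (@RInt_ext C_R_CompleteNormedModule); intros t _; apply H.
Qed.

Lemma cint_plus (F G : C -> C) (a b : R) : conR F -> conR G ->
  cint (fun t => F t + G t)%C a b = (cint F a b + cint G a b)%C.
Proof.
intros HF HG; apply cint_unique.
exact (is_RInt_plus _ _ a b _ _ (is_cint F a b HF) (is_cint G a b HG)).
Qed.

Lemma cint_chasles (F : C -> C) (a b c : R) : conR F ->
  (cint F a b + cint F b c)%C = cint F a c.
Proof.
intros HF; symmetry; apply cint_unique.
exact (is_RInt_Chasles _ a b c _ _ (is_cint F a b HF) (is_cint F b c HF)).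
Qed.

(** The integral lives in C as a real vector space, where only real scalars are available; a complex
    factor is handled on real and imaginary parts. *)
Lemma cint_scal (F : C -> C) (c : C) (a b : R) : conR F ->
  cint (fun t => c * F t)%C a b = (c * cint F a b)%C.
Proof.
intros HF; apply cint_unique.
assert (H := is_cint F a b HF).
assert (H1 := is_RInt_fct_extend_fst (U := R_NormedModule) (V := R_NormedModule)
  _ a b _ H).
assert (H2 := is_RInt_fct_extend_snd (U := R_NormedModule) (V := R_NormedModule)
  _ a b _ H).
apply (is_RInt_fct_extend_pair (U := R_NormedModule) (V := R_NormedModule)
  (fun t => (c * F (RtoC t))%C) a b
  (fst c * fst (cint F a b) - snd c * snd (cint F a b))
  (fst c * snd (cint F a b) + snd c * fst (cint F a b))).
- apply (is_RInt_minus (V := R_NormedModule)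
    (fun t => fst c * fst (F (RtoC t))) (fun t => snd c * snd (F (RtoC t))));
  now apply (is_RInt_scal (V := R_NormedModule)).
- apply (is_RInt_plus (V := R_NormedModule)
    (fun t => fst c * snd (F (RtoC t))) (fun t => snd c * fst (F (RtoC t))));
  now apply (is_RInt_scal (V := R_NormedModule)).
Qed.

Lemma cint_const (c : C) (a b : R) :
  cint (fun _ => c) a b = (RtoC (b - a) * c)%C.
Proof.
apply cint_unique; rewrite <- scal_R_Cmult.
exact (is_RInt_const (V := C_R_NormedModule) a b c).
Qed.

Lemma cint_bound (F : C -> C) (a b M : R) : conR F -> a <= b ->
  (forall t : R, a <= t <= b -> Cmod (F (RtoC t)) <= M) ->
  Cmod (cint F a b) <= (b - a) * M.
Proof.
intros HF Hab HM; rewrite Cmod_norm.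
apply (norm_RInt_le_const (V := C_R_NormedModule) (fun t => F (RtoC t)) a b);
  trivial; [|now apply is_cint].
intros t Ht; rewrite <- Cmod_norm; auto.
Qed.

Lemma cint_bound_fun (F : C -> C) (g : R -> R) (a b l : R) : conR F -> a <= b ->
  (forall t : R, a <= t <= b -> Cmod (F (RtoC t)) <= g t) ->
  is_RInt g a b l -> Cmod (cint F a b) <= l.
Proof.
intros HF Hab HM Hg; rewrite Cmod_norm.
apply (norm_RInt_le (V := C_R_NormedModule) (fun t => F (RtoC t)) g a b);
  trivial; [|now apply is_cint].
intros t Ht; rewrite <- Cmod_norm; auto.
Qed.

Lemma cint_derive (F F' : C -> C) (a b : R) :
  (forall t : R, cder F (RtoC t) (F' (RtoC t))) -> conR F' ->
  cint F' a b = (F (RtoC b) - F (RtoC a))%C.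
Proof.
intros HF HF'; apply cint_unique.
apply (is_RInt_derive (V := C_R_CompleteNormedModule)
  (fun t => F (RtoC t)) (fun t => F' (RtoC t)));
  [|intros; now apply conR_continuous].
intros t _; split; [apply is_linear_scal_l|].
intros x Hx eps.
assert (Ex : t = x)
  by exact (@is_filter_lim_locally_unique R_AbsRing R_NormedModule _ _ Hx).
subst x.
destruct (HF t eps (cond_pos eps)) as [d [Hd H1]].
exists (mkposreal d Hd); intros s Hs.
change (Rabs (s - t) < d) in Hs.
rewrite <- Cmod_R in Hs; specialize (H1 _ Hs).
rewrite <- Cmod_norm, scal_R_Cmult.
change (Cmod (F (RtoC s) - F (RtoC t) - RtoC (s - t) * F' (RtoC t))%C
  <= eps * Rabs (s - t)).
replace (RtoC t + RtoC (s - t))%C with (RtoC s) in H1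
  by (rewrite RtoC_minus; ring).
rewrite Cmod_R in H1.
now replace (RtoC (s - t) * F' (RtoC t))%C with (F' (RtoC t) * RtoC (s - t))%C
  by ring.
Qed.

(** * Goursat's theorem for rectangles *)

Lemma nested_intervals (u v : nat -> R) :
  (forall n, u n <= u (S n)) -> (forall n, v (S n) <= v n) ->
  (forall n, u n <= v n) -> exists x, forall n, u n <= x <= v n.
Proof.
intros Hu Hv Huv.
assert (Huk : forall n k, u n <= u (k + n)%nat).
{ intros n; induction k as [|k IH]; simpl; [lra|].
  eapply Rle_trans; [exact IH|apply Hu]. }
assert (Hvk : forall n k, v (k + n)%nat <= v n).
{ intros n; induction k as [|k IH]; simpl; [lra|].
  eapply Rle_trans; [apply Hv|exact IH]. }
assert (Hall : forall n m, u m <= v n).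
{ intros n m; apply Rle_trans with (u (n + m)%nat); [apply Huk|].
  apply Rle_trans with (v (m + n)%nat); [|apply Hvk].
  rewrite (Nat.add_comm m n); apply Huv. }
destruct (completeness (fun x => exists n, x = u n)) as [x [Hx1 Hx2]].
- exists (v 0%nat); intros x [n ->]; apply Hall.
- now exists (u 0%nat), 0%nat.
- exists x; intros n; split.
  + apply Hx1; now exists n.
  + apply Hx2; intros w [m ->]; apply Hall.
Qed.

(** The combinatorial core of Goursat's argument: [J x y s] stands for the boundary integral over
    the rectangle with lower left corner (x, y) and sides [a * s], [b * s]. If it is nonzero, one of
    the four quarters keeps at least a quarter of the modulus, so |J| / s^2 does not decrease along
    a nested sequence, against the local estimate at the common point. *)
Lemma four_section_vanishing (J : R -> R -> R -> C) (a b : R) :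
  0 < a -> 0 < b ->
  (forall x y s, 0 < s -> J x y (2 * s) =
     (J x y s + J (x + a * s)%R y s + J x (y + b * s)%R s
      + J (x + a * s)%R (y + b * s)%R s)%C) ->
  (forall x0 y0 eps, 0 < eps -> exists delta, 0 < delta /\
     forall x y s, 0 < s < delta -> x <= x0 <= x + a * s ->
       y <= y0 <= y + b * s -> Cmod (J x y s) <= eps * s ^ 2) ->
  forall x y s, 0 < s -> J x y s = 0.
Proof.
intros Ha Hb Hadd Hloc x y s Hs.
apply Cmod_eq_0; destruct (Rle_lt_or_eq_dec _ _ (Cmod_ge_0 (J x y s)))
  as [Hpos|Heq]; [exfalso|now symmetry].
set (c := Cmod (J x y s) / s ^ 2).
assert (Hs2 : 0 < s ^ 2) by (apply pow_lt; trivial).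
assert (Hc : 0 < c) by now apply Rdiv_lt_0_compat.
pose (sn := fun n => s / 2 ^ n).
assert (Hsn : forall n, 0 < sn n).
{ intros n; apply Rdiv_lt_0_compat; trivial; apply pow_lt; lra. }
assert (HsS : forall n, sn n = 2 * sn (S n)).
{ intros n; unfold sn; simpl; field; apply pow_nonzero; lra. }
pose (good := fun n (p : R * R) =>
  c * sn n ^ 2 <= Cmod (J (fst p) (snd p) (sn n))).
(* Stating the choice as an implication from [good n p] makes it total, so it can be iterated by a
   plain recursion on corners. *)
assert (step : forall n p, {p' : R * R | good n p -> good (S n) p' /\
  fst p <= fst p' <= fst p + a * sn (S n) /\
  snd p <= snd p' <= snd p + b * sn (S n)}).
{ intros n p; apply constructive_indefinite_description.
  destruct (classic (good n p)) as [Hg|Hg]; [|exists p; tauto].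
  (* If all four quarters failed, the triangle inequality would give less than 4 c [sn (S n)]^2,
     which is c [sn n]^2. *)
  apply NNPP; intros Hno.
  assert (Hlt : forall p', fst p <= fst p' <= fst p + a * sn (S n) ->
    snd p <= snd p' <= snd p + b * sn (S n) ->
    Cmod (J (fst p') (snd p') (sn (S n))) < c * sn (S n) ^ 2).
  { intros p' H1 H2; apply Rnot_le_lt; intros H3; apply Hno.
    exists p'; intros _; split; [exact H3|split; trivial]. }
  assert (K1 := Hsn (S n)).
  assert (K2 := Rmult_lt_0_compat _ _ Ha K1).
  assert (K3 := Rmult_lt_0_compat _ _ Hb K1).
  assert (L1 := Hlt (fst p, snd p)).
  assert (L2 := Hlt (fst p + a * sn (S n), snd p)).
  assert (L3 := Hlt (fst p, snd p + b * sn (S n))).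
  assert (L4 := Hlt (fst p + a * sn (S n), snd p + b * sn (S n))).
  simpl fst in *; simpl snd in *.
  specialize (L1 ltac:(lra) ltac:(lra)); specialize (L2 ltac:(lra) ltac:(lra)).
  specialize (L3 ltac:(lra) ltac:(lra)); specialize (L4 ltac:(lra) ltac:(lra)).
  unfold good in Hg; rewrite (HsS n), (Hadd _ _ _ K1) in Hg.
  match type of Hg with _ <= Cmod (?u + ?v + ?w + ?t)%C =>
    assert (T1 := Cmod_triangle (u + v + w) t);
    assert (T2 := Cmod_triangle (u + v) w);
    assert (T3 := Cmod_triangle u v) end.
  nra. }
pose (u := fix u n := match n with
  | O => (x, y) | S n => proj1_sig (step n (u n)) end).
assert (Hgood : forall n, good n (u n)).
{ induction n as [|n IH].
  - unfold good, sn; simpl; replace (s / 1) with s by field.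
    unfold c; right; field; lra.
  - simpl; destruct (step n (u n)) as [p' Hp']; simpl; now apply Hp'. }
assert (Hnest : forall n,
  fst (u n) <= fst (u (S n)) <= fst (u n) + a * sn (S n) /\
  snd (u n) <= snd (u (S n)) <= snd (u n) + b * sn (S n)).
{ intros n; simpl; destruct (step n (u n)) as [p' Hp']; simpl.
  now apply Hp'. }
destruct (nested_intervals (fun n => fst (u n)) (fun n => fst (u n) + a * sn n))
  as [x0 Hx0].
{ intros n; apply Hnest. }
{ intros n; destruct (Hnest n) as [H _]; rewrite (HsS n); lra. }
{ intros n; assert (H := Rmult_lt_0_compat _ _ Ha (Hsn n)); lra. }
destruct (nested_intervals (fun n => snd (u n)) (fun n => snd (u n) + b * sn n))
  as [y0 Hy0].
{ intros n; apply Hnest. }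
{ intros n; destruct (Hnest n) as [_ H]; rewrite (HsS n); lra. }
{ intros n; assert (H := Rmult_lt_0_compat _ _ Hb (Hsn n)); lra. }
(* Any tolerance below the preserved ratio [c] gives the contradiction. *)
destruct (Hloc x0 y0 (c / 2) ltac:(lra)) as [d [Hd Hsmall]].
assert (Hn : exists n, sn n < d).
{ destruct (pow_lt_1_zero (/ 2)) with (y := d / s) as [n Hn].
  - rewrite Rabs_pos_eq; lra.
  - now apply Rdiv_lt_0_compat.
  - exists n; specialize (Hn n (le_n n)).
    rewrite Rabs_pos_eq in Hn by (apply pow_le; lra).
    unfold sn; rewrite pow_inv in Hn.
    apply Rmult_lt_compat_l with (r := s) in Hn; trivial.
    now replace (s * (d / s)) with d in Hn by (field; lra). }
destruct Hn as [n Hn].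
specialize (Hsmall _ _ _ (conj (Hsn n) Hn) (Hx0 n) (Hy0 n)).
assert (Hg := Hgood n); unfold good in Hg.
assert (0 < sn n ^ 2) by (apply pow_lt, Hsn).
nra.
Qed.

Definition line_int (f : C -> C) (p d : C) (t1 t2 : R) : C :=
  (d * cint (fun t => f (p + d * t)%C) t1 t2)%C.

(** The boundary is run counterclockwise: bottom, right, top, left. The real parameter of each side
    is a coordinate of the plane, so sides of adjacent rectangles match literally. *)
Definition rect_int (f : C -> C) (x1 x2 y1 y2 : R) : C :=
  (line_int f (Ci * y1) 1 x1 x2 + line_int f x2 Ci y1 y2
   - line_int f (Ci * y2) 1 x1 x2 - line_int f x1 Ci y1 y2)%C.

Lemma conR_affine (f : C -> C) (p d : C) :
  (forall z, ccont f z) -> conR (fun t => f (p + d * t)%C).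
Proof.
intros Hf t; apply ccont_comp; [apply Hf|].
eapply cder_ccont, cder_affine.
Qed.

Lemma line_int_bound (f : C -> C) (p d : C) (t1 t2 M : R) :
  (forall z, ccont f z) -> t1 <= t2 ->
  (forall t : R, t1 <= t <= t2 -> Cmod (f (p + d * t)%C) <= M) ->
  Cmod (line_int f p d t1 t2) <= Cmod d * ((t2 - t1) * M).
Proof.
intros Hf Ht HM; unfold line_int; rewrite Cmod_mult.
apply Rmult_le_compat_l; [apply Cmod_ge_0|].
apply cint_bound; trivial; now apply conR_affine.
Qed.

Lemma line_int_chasles (f : C -> C) (p d : C) (t1 t2 t3 : R) :
  (forall z, ccont f z) ->
  line_int f p d t1 t3 = (line_int f p d t1 t2 + line_int f p d t2 t3)%C.
Proof.
intros Hf; unfold line_int.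
rewrite <- (cint_chasles _ t1 t2 t3) by now apply conR_affine.
ring.
Qed.

Lemma line_int_plus (f g : C -> C) (p d : C) (t1 t2 : R) :
  (forall z, ccont f z) -> (forall z, ccont g z) ->
  line_int (fun z => f z + g z)%C p d t1 t2
  = (line_int f p d t1 t2 + line_int g p d t1 t2)%C.
Proof.
intros Hf Hg; unfold line_int.
rewrite (cint_plus (fun t => f (p + d * t)%C) (fun t => g (p + d * t)%C))
  by now apply conR_affine.
ring.
Qed.

Lemma line_int_derive (F f : C -> C) (p d : C) (t1 t2 : R) :
  (forall z, cder F z (f z)) -> (forall z, ccont f z) ->
  line_int f p d t1 t2 = (F (p + d * t2) - F (p + d * t1))%C.
Proof.
intros HF Hf; unfold line_int.
rewrite <- (cint_scal (fun t => f (p + d * t)%C)) by now apply conR_affine.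
apply (cint_derive (fun t => F (p + d * t)%C) (fun t => d * f (p + d * t))%C).
- intros t; rewrite Cmult_comm.
  apply (cder_comp F (fun t => p + d * t)%C); [apply HF|apply cder_affine].
- intros t; apply ccont_mult; [apply ccont_const|now apply conR_affine].
Qed.

Lemma RtoC_inj_neq (x y : R) : x <> y -> RtoC x <> RtoC y.
Proof. intros H E; apply H; now apply RtoC_inj. Qed.

Lemma Cmod_le_sum (x y : R) : Cmod (x + Ci * y)%C <= Rabs x + Rabs y.
Proof.
eapply Rle_trans; [apply Cmod_triangle|].
rewrite Cmod_mult, Cmod_Ci, !Cmod_R; lra.
Qed.

Lemma goursat_rectangle (f : C -> C) (x1 x2 y1 y2 : R) :
  entire f -> x1 < x2 -> y1 < y2 -> rect_int f x1 x2 y1 y2 = 0.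
Proof.
intros Hf Hx Hy.
assert (Cf : forall z, ccont f z) by (intros; now apply entire_ccont).
set (a := x2 - x1); set (b := y2 - y1).
assert (Ha : 0 < a) by (unfold a; lra).
assert (Hb : 0 < b) by (unfold b; lra).
set (J := fun x y s => rect_int f x (x + a * s) y (y + b * s)).
cut (J x1 y1 1 = 0).
{ unfold J, a, b.
  replace (x1 + (x2 - x1) * 1) with x2 by ring.
  now replace (y1 + (y2 - y1) * 1) with y2 by ring. }
apply (four_section_vanishing J a b Ha Hb); [| |lra].
- intros x y s Hs; unfold J, rect_int.
  replace (x + a * (2 * s)) with (x + a * s + a * s) by ring.
  replace (y + b * (2 * s)) with (y + b * s + b * s) by ring.
  set (X1 := x + a * s); set (X2 := X1 + a * s).
  set (Y1 := y + b * s); set (Y2 := Y1 + b * s).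
  rewrite (line_int_chasles f (Ci * y) 1 x X1 X2 Cf).
  rewrite (line_int_chasles f (Ci * Y2) 1 x X1 X2 Cf).
  rewrite (line_int_chasles f X2 Ci y Y1 Y2 Cf).
  rewrite (line_int_chasles f x Ci y Y1 Y2 Cf).
  ring.
- intros x0 y0 eps He.
  set (z0 := (x0 + Ci * y0)%C); set (d := C_derive f z0).
  assert (Hab2 : 0 < 2 * (a + b) ^ 2).
  { apply Rmult_lt_0_compat; [lra|apply pow_lt; lra]. }
  (* The perimeter is 2 (a + b) s, and points of a rectangle containing [z0] lie within (a + b) s of
     it. With error rate e the integral is at most 2 e (a + b)^2 s^2, whence this choice of e. *)
  destruct (entire_cder f z0 Hf (eps / (2 * (a + b) ^ 2))) as [del [Hdel Hd]].
  { now apply Rdiv_lt_0_compat. }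
  set (e := eps / (2 * (a + b) ^ 2)) in Hd.
  assert (He' : 0 < e) by now apply Rdiv_lt_0_compat.
  exists (del / (a + b)); split; [apply Rdiv_lt_0_compat; lra|].
  intros x y s [Hs Hsd] Hx0 Hy0.
  assert (Hsd' : (a + b) * s < del).
  { apply Rmult_lt_compat_l with (r := a + b) in Hsd; [|lra].
    now replace ((a + b) * (del / (a + b))) with del in Hsd by (field; lra). }
  (* [A] is the first-order Taylor polynomial at [z0] and [g] the remainder. Only [g] needs an
     estimate, since [A] has an explicit primitive. *)
  set (A := fun z => ((f z0 - d * z0) + d * z)%C).
  set (g := fun z => (f z + (- (f z0 - d * z0) + - d * z))%C).
  assert (CA : forall z, ccont A z) by (intros z; eapply cder_ccont, cder_affine).
  assert (Cg : forall z, ccont g z).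
  { intros z; apply ccont_plus; [apply Cf|eapply cder_ccont, cder_affine]. }
  assert (Efg : f = fun z => (g z + A z)%C).
  { apply functional_extensionality; intros z; unfold g, A; ring. }
  assert (HA : forall p q t1 t2, line_int A p q t1 t2 =
    ((f z0 - d * z0) * (p + q * t2) + d * (p + q * t2) * (p + q * t2) / 2
     - ((f z0 - d * z0) * (p + q * t1) + d * (p + q * t1) * (p + q * t1) / 2))%C).
  { intros p q t1 t2.
    apply (line_int_derive
      (fun z => (f z0 - d * z0) * z + d * z * z / 2)%C A); [|exact CA].
    intros z; eapply cder_eq.
    - apply cder_plus; [apply cder_mult; [apply cder_const|apply cder_id]|].
      apply cder_mult; [|apply cder_const].
      apply cder_mult; [|apply cder_id].
      apply cder_mult; [apply cder_const|apply cder_id].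
    - unfold A; simpl; field; apply RtoC_inj_neq; lra. }
  unfold J, rect_int; rewrite Efg, !line_int_plus by assumption.
  rewrite !HA.
  set (X := x + a * s); set (Y := y + b * s).
  assert (Has := Rmult_lt_0_compat _ _ Ha Hs).
  assert (Hbs := Rmult_lt_0_compat _ _ Hb Hs).
  set (M := e * ((a + b) * s)).
  assert (Hg : forall u v : R, x <= u <= X -> y <= v <= Y ->
    Cmod (g (u + Ci * v)%C) <= M).
  { unfold X, Y; intros u v Hu Hv.
    assert (Hdist : Cmod ((u + Ci * v) - z0)%C <= (a + b) * s).
    { replace (u + Ci * v - z0)%C with (RtoC (u - x0) + Ci * RtoC (v - y0))%C
        by (unfold z0; rewrite !RtoC_minus; ring).
      eapply Rle_trans; [apply Cmod_le_sum|].
      assert (Rabs (u - x0) <= a * s) by (apply Rabs_le; lra).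
      assert (Rabs (v - y0) <= b * s) by (apply Rabs_le; lra).
      lra. }
    specialize (Hd (u + Ci * v - z0)%C ltac:(lra)).
    apply Rle_trans with (e * Cmod (u + Ci * v - z0)%C).
    - replace (g (u + Ci * v)%C) with
        (f (z0 + (u + Ci * v - z0)) - f z0 - d * (u + Ci * v - z0))%C;
        [exact Hd|].
      replace (z0 + (u + Ci * v - z0))%C with (u + Ci * v)%C by ring.
      unfold g; ring.
    - apply Rmult_le_compat_l; lra. }
  assert (B1 := line_int_bound g (Ci * y) 1 x X M Cg ltac:(unfold X; lra)).
  assert (B2 := line_int_bound g (Ci * Y) 1 x X M Cg ltac:(unfold X; lra)).
  assert (B3 := line_int_bound g X Ci y Y M Cg ltac:(unfold Y; lra)).
  assert (B4 := line_int_bound g x Ci y Y M Cg ltac:(unfold Y; lra)).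
  rewrite Cmod_1, Rmult_1_l in B1, B2; rewrite Cmod_Ci, Rmult_1_l in B3, B4.
  specialize (B1 ltac:(intros t Ht; replace (Ci * y + 1 * t)%C with (t + Ci * y)%C
    by ring; apply Hg; unfold X, Y in *; lra)).
  specialize (B2 ltac:(intros t Ht; replace (Ci * Y + 1 * t)%C with (t + Ci * Y)%C
    by ring; apply Hg; unfold X, Y in *; lra)).
  specialize (B3 ltac:(intros t Ht; apply Hg; unfold X, Y in *; lra)).
  specialize (B4 ltac:(intros t Ht; apply Hg; unfold X, Y in *; lra)).
  replace (X - x) with (a * s) in B1, B2 by (unfold X; ring).
  replace (Y - y) with (b * s) in B3, B4 by (unfold Y; ring).
  (* The values of the primitive of [A] at the four corners cancel. *)
  match goal with |- Cmod ?w <= _ => replace w with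
    ((line_int g (Ci * y) 1 x X + line_int g X Ci y Y)
     + (- line_int g (Ci * Y) 1 x X + - line_int g x Ci y Y))%C
    by (field; apply RtoC_inj_neq; lra) end.
  apply Rle_trans with ((a * s * M + b * s * M) + (a * s * M + b * s * M)).
  + eapply Rle_trans; [apply Cmod_triangle|]; apply Rplus_le_compat;
      (eapply Rle_trans; [apply Cmod_triangle|]); rewrite ?Cmod_opp; lra.
  + unfold M, e; right; field; lra.
Qed.

(** * The complex exponential *)

Definition cexp (w : C) : C :=
  (exp (fst w) * cos (snd w), exp (fst w) * sin (snd w)).

Lemma cexp_plus (z w : C) : cexp (z + w)%C = (cexp z * cexp w)%C.
Proof.
unfold cexp, Cmult; simpl; rewrite exp_plus, cos_plus, sin_plus.
f_equal; ring.
Qed.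

Lemma cexp_0 : cexp 0 = 1.
Proof.
unfold cexp; simpl; rewrite exp_0, cos_0, sin_0.
unfold RtoC; f_equal; ring.
Qed.

Lemma cexp_opp (w : C) : (cexp w * cexp (- w))%C = 1.
Proof.
rewrite <- cexp_plus; replace (w + - w)%C with (RtoC 0) by ring; apply cexp_0.
Qed.

Lemma Cmod_cexp (w : C) : Cmod (cexp w) = exp (fst w).
Proof.
unfold cexp, Cmod; simpl.
assert (H := sin2_cos2 (snd w)); unfold Rsqr in H.
match goal with |- sqrt ?u = _ => replace u with (exp (fst w) * exp (fst w)
  * (sin (snd w) * sin (snd w) + cos (snd w) * cos (snd w))) by ring end.
rewrite H, Rmult_1_r; apply sqrt_square; left; apply exp_pos.
Qed.

Lemma cexp_Ci (t : R) : cexp (Ci * t)%C = (cos t, sin t).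
Proof.
unfold cexp; simpl.
replace (0 * t - 1 * 0) with 0 by ring; replace (0 * 0 + 1 * t) with t by ring.
rewrite exp_0; f_equal; ring.
Qed.

Lemma cexp_RtoC (x : R) : cexp x = exp x.
Proof.
unfold cexp; simpl; rewrite cos_0, sin_0; unfold RtoC; f_equal; ring.
Qed.

Lemma derivable_pt_lim_small (f : R -> R) (x l : R) : derivable_pt_lim f x l ->
  forall eps, 0 < eps -> exists delta, 0 < delta /\
    forall h, Rabs h < delta -> Rabs (f (x + h) - f x - l * h) <= eps * Rabs h.
Proof.
intros H eps He; destruct (H eps He) as [d Hd].
exists d; split; [apply cond_pos|]; intros h Hh.
destruct (Req_dec h 0) as [->|Hn].
- replace (f (x + 0) - f x - l * 0) with 0 by (rewrite Rplus_0_r; ring).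
  rewrite !Rabs_R0; lra.
- specialize (Hd h Hn Hh).
  replace (f (x + h) - f x - l * h) with (((f (x + h) - f x) / h - l) * h)
    by (field; trivial).
  rewrite Rabs_mult; apply Rmult_le_compat_r; [apply Rabs_pos|lra].
Qed.

Lemma cder_cexp_0 : cder cexp 0 1.
Proof.
intros eps0 He0.
(* The real part of the remainder costs at most 3 [eps] |h| and the imaginary part at most 6 [eps]
   |h|. Requiring also |h| < [eps] <= 1 keeps |1 + x| <= 2 and makes (exp x - 1) sin y of second
   order. *)
set (eps := Rmin 1 (eps0 / 9)).
assert (He : 0 < eps) by (apply Rmin_pos; lra).
assert (He1 : eps <= 1) by apply Rmin_l.
assert (He9 : eps <= eps0 / 9) by apply Rmin_r.
destruct (derivable_pt_lim_small _ _ _ (derivable_pt_lim_exp 0) eps He)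
  as [d1 [Hd1 H1]].
destruct (derivable_pt_lim_small _ _ _ (derivable_pt_lim_cos 0) eps He)
  as [d2 [Hd2 H2]].
destruct (derivable_pt_lim_small _ _ _ (derivable_pt_lim_sin 0) eps He)
  as [d3 [Hd3 H3]].
exists (Rmin eps (Rmin d1 (Rmin d2 d3))); split.
- apply Rmin_pos; [trivial|repeat apply Rmin_pos; trivial].
- intros h Hh.
  assert (M1 := Rmin_l eps (Rmin d1 (Rmin d2 d3))).
  assert (M2 := Rmin_r eps (Rmin d1 (Rmin d2 d3))).
  assert (M3 := Rmin_l d1 (Rmin d2 d3)).
  assert (M4 := Rmin_r d1 (Rmin d2 d3)).
  assert (M5 := Rmin_l d2 d3); assert (M6 := Rmin_r d2 d3).
  assert (Hm := Rmax_Cmod h).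
  assert (Hx := Rle_trans _ _ _ (Rmax_l _ _) Hm).
  assert (Hy := Rle_trans _ _ _ (Rmax_r _ _) Hm).
  rewrite Cplus_0_l, cexp_0, Cmult_1_l.
  destruct h as [x y]; set (n := Cmod (x, y)) in *; simpl in Hx, Hy.
  clear Hm.
  specialize (H1 x ltac:(lra)); specialize (H2 y ltac:(lra)).
  specialize (H3 y ltac:(lra)).
  rewrite !Rplus_0_l, exp_0 in H1.
  rewrite !Rplus_0_l, cos_0, sin_0 in H2.
  rewrite !Rplus_0_l, sin_0, cos_0 in H3.
  assert (Hcy := COS_bound y).
  apply Rle_trans with (Rabs (exp x * cos y - 1 - x) + Rabs (exp x * sin y - y)).
  + replace (cexp (x, y) - 1 - (x, y))%C
      with ((exp x * cos y - 1 - x)%R + Ci * (exp x * sin y - y)%R)%C;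
      [apply Cmod_le_sum|].
    apply injective_projections; simpl; ring.
  + assert (Ax := Rabs_pos x); assert (Ay := Rabs_pos y).
    assert (Rabs (exp x * cos y - 1 - x) <= eps * n + 2 * eps * n).
    { replace (exp x * cos y - 1 - x)
        with ((exp x - 1 - 1 * x) * cos y + (1 + x) * (cos y - 1 - - 0 * y))
        by ring.
      eapply Rle_trans; [apply Rabs_triang|].
      rewrite !Rabs_mult; apply Rplus_le_compat.
      - assert (Rabs (cos y) <= 1) by (apply Rabs_le; lra).
        assert (P := Rabs_pos (exp x - 1 - 1 * x)).
        assert (Q := Rabs_pos (cos y)).
        apply Rle_trans with (Rabs (exp x - 1 - 1 * x) * 1); nra.
      - assert (Rabs (1 + x) <= 2).
        { eapply Rle_trans; [apply Rabs_triang|]; rewrite Rabs_R1; lra. }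
        assert (P := Rabs_pos (cos y - 1 - - 0 * y)).
        apply Rle_trans with (2 * Rabs (cos y - 1 - - 0 * y)); nra. }
    assert (Rabs (exp x * sin y - y) <= 6 * eps * n).
    { replace (exp x * sin y - y)
        with ((exp x - 1) * sin y + (sin y - 0 - 1 * y)) by ring.
      assert (Rabs (exp x - 1) <= 2 * Rabs x).
      { replace (exp x - 1) with ((exp x - 1 - 1 * x) + x) by ring.
        eapply Rle_trans; [apply Rabs_triang|]; nra. }
      assert (Rabs (sin y) <= 2 * Rabs y).
      { replace (sin y) with ((sin y - 0 - 1 * y) + y) by ring.
        eapply Rle_trans; [apply Rabs_triang|]; nra. }
      eapply Rle_trans; [apply Rabs_triang|]; rewrite Rabs_mult.
      assert (P := Rabs_pos (exp x - 1)); assert (Q := Rabs_pos (sin y)).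
      assert (Rabs (exp x - 1) * Rabs (sin y) <= (2 * eps) * (2 * n)).
      { apply Rmult_le_compat; lra. }
      nra. }
    assert (0 <= n) by apply Cmod_ge_0.
    nra.
Qed.

Lemma cder_cexp (w : C) : cder cexp w (cexp w).
Proof.
intros eps He.
assert (Hm : 0 < Cmod (cexp w)) by (rewrite Cmod_cexp; apply exp_pos).
destruct (cder_cexp_0 (eps / Cmod (cexp w))) as [d [Hd H]].
{ now apply Rdiv_lt_0_compat. }
exists d; split; trivial; intros h Hh; specialize (H h Hh).
rewrite Cplus_0_l, cexp_0 in H.
rewrite cexp_plus.
replace (cexp w * cexp h - cexp w - cexp w * h)%C
  with (cexp w * (cexp h - 1 - 1 * h))%C by ring.
rewrite Cmod_mult.
apply Rmult_le_compat_l with (r := Cmod (cexp w)) in H; [|lra].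
replace (Cmod (cexp w) * (eps / Cmod (cexp w) * Cmod h))
  with (eps * Cmod h) in H by (field; lra).
exact H.
Qed.

(** * Cauchy's formula on circles *)

(* The circle of radius [exp x] around [a] is parametrized by
   [a + cexp (x + Ci * t)], so that changing the radius moves the segment
   [x + Ci * t], [0 <= t <= 2 * PI], horizontally. *)
Definition circ_fun (f : C -> C) (a : C) (n : R) (w : C) : C :=
  (f (a + cexp w) * cexp (- n * w))%C.

(** With z = a + e^w and dz = i e^w dt this is the contour integral of f(z) / (z - a)^(n + 1),
    divided by i, over the circle of radius [exp x]. For natural [n] and entire [f] its value is 2
    PI f^(n)(a) / n!. *)
Definition circ (f : C -> C) (a : C) (n x : R) : C :=
  cint (fun t => circ_fun f a n (x + Ci * t)%C) 0 (2 * PI).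

Lemma ccont_cexp (w : C) : ccont cexp w.
Proof. eapply cder_ccont, cder_cexp. Qed.

Lemma ccont_circ_fun (f : C -> C) (a : C) (n : R) (w : C) :
  (forall z, ccont f z) -> ccont (circ_fun f a n) w.
Proof.
intros Hf; apply ccont_mult.
- apply (ccont_comp f (fun w => a + cexp w)%C); [apply Hf|].
  apply ccont_plus; [apply ccont_const|apply ccont_cexp].
- apply (ccont_comp cexp (fun w => - n * w)%C); [apply ccont_cexp|].
  apply ccont_mult; [apply ccont_const|eapply cder_ccont, cder_id].
Qed.

Lemma conR_circ (f : C -> C) (a : C) (n x : R) : (forall z, ccont f z) ->
  conR (fun t => circ_fun f a n (x + Ci * t)%C).
Proof.
intros Hf; apply conR_affine; intros w; now apply ccont_circ_fun.
Qed.

Lemma cder_circ_fun (f f' : C -> C) (a : C) (n : R) (w : C) :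
  (forall z, cder f z (f' z)) ->
  cder (circ_fun f a n) w
    (circ_fun f' a (n - 1) w - n * circ_fun f a n w)%C.
Proof.
intros Hf; eapply cder_eq.
- apply cder_mult.
  + apply (cder_comp f (fun w => a + cexp w)%C); [apply Hf|].
    apply cder_plus; [apply cder_const|apply cder_cexp].
  + apply (cder_comp cexp (fun w => - n * w)%C); [apply cder_cexp|].
    apply cder_mult; [apply cder_const|apply cder_id].
- unfold circ_fun; simpl.
  replace (- (n - 1)%R * w)%C with (w + - n * w)%C
    by (rewrite RtoC_minus; ring).
  rewrite cexp_plus; ring.
Qed.

Lemma cexp_2PI (k : nat) : cexp (INR k * (Ci * (2 * PI)%R))%C = 1.
Proof.
induction k as [|k IH].
- replace (INR 0 * (Ci * (2 * PI)%R))%C with (RtoC 0) by (simpl; ring).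
  apply cexp_0.
- rewrite S_INR.
  replace ((INR k + 1)%R * (Ci * (2 * PI)%R))%C
    with (INR k * (Ci * (2 * PI)%R) + Ci * (2 * PI)%R)%C
    by (rewrite RtoC_plus; ring).
  rewrite cexp_plus, IH, cexp_Ci, cos_2PI, sin_2PI.
  now rewrite Cmult_1_l.
Qed.

Lemma circ_fun_periodic (f : C -> C) (a w : C) (n : nat) :
  circ_fun f a (INR n) (w + Ci * (2 * PI)%R)%C = circ_fun f a (INR n) w.
Proof.
unfold circ_fun; f_equal.
- rewrite cexp_plus.
  replace (Ci * (2 * PI)%R)%C with (INR 1 * (Ci * (2 * PI)%R))%C
    by (simpl; ring).
  now rewrite cexp_2PI, Cmult_1_r.
- assert (H := cexp_opp (INR n * (Ci * (2 * PI)%R))).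
  rewrite cexp_2PI, Cmult_1_l in H.
  replace (- INR n * (w + Ci * (2 * PI)%R))%C
    with (- INR n * w + - (INR n * (Ci * (2 * PI)%R)))%C by ring.
  now rewrite cexp_plus, H, Cmult_1_r.
Qed.

Lemma circ_lin (f g : C -> C) (a c : C) (n x : R) :
  (forall z, ccont f z) -> (forall z, ccont g z) ->
  circ (fun z => f z + c * g z)%C a n x = (circ f a n x + c * circ g a n x)%C.
Proof.
intros Hf Hg; unfold circ.
rewrite <- (cint_scal (fun t => circ_fun g a n (x + Ci * t)%C))
  by now apply conR_circ.
rewrite <- (cint_plus (fun t => circ_fun f a n (x + Ci * t)%C)
  (fun t => c * circ_fun g a n (x + Ci * t))%C).
- apply cint_ext; intros t; unfold circ_fun; ring.
- now apply conR_circ.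
- intros t; apply ccont_mult; [apply ccont_const|].
  now apply (conR_circ g a n x Hg t).
Qed.

Lemma Cmod_cexp_circ (x t n : R) :
  Cmod (cexp (- n * (x + Ci * t))) = exp (- n * x).
Proof. rewrite Cmod_cexp; simpl; f_equal; ring. Qed.

Lemma circ_bound (f : C -> C) (a : C) (n x M : R) : (forall z, ccont f z) ->
  (forall t : R, Cmod (f (a + cexp (x + Ci * t))%C) <= M) ->
  Cmod (circ f a n x) <= 2 * PI * (M * exp (- n * x)).
Proof.
intros Hf HM; unfold circ; assert (HPI := PI_RGT_0).
rewrite <- (Rminus_0_r (2 * PI)) at 2.
apply cint_bound; [now apply conR_circ|lra|].
intros t _; unfold circ_fun; rewrite Cmod_mult, Cmod_cexp_circ.
apply Rmult_le_compat_r; [left; apply exp_pos|apply HM].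
Qed.

Lemma circ_translate (f : C -> C) (a h : C) (n x : R) :
  circ f (a + h)%C n x = circ (fun z => f (z + h)%C) a n x.
Proof.
apply cint_ext; intros t; unfold circ_fun.
now replace (a + h + cexp (x + Ci * t))%C with (a + cexp (x + Ci * t) + h)%C
  by ring.
Qed.

(** The integrand of [circ f a (INR (S n))] has derivative [circ_fun f' a (INR n)] minus n + 1 times
    itself. Integrated over a full period, this derivative gives 0. *)
Lemma circ_parts (f f' : C -> C) (a : C) (n : nat) (x : R) :
  (forall z, cder f z (f' z)) -> (forall z, ccont f' z) ->
  circ f' a (INR n) x = (INR (S n) * circ f a (INR (S n)) x)%C.
Proof.
intros Hf Hf'.
assert (Cf : forall z, ccont f z) by (intros z; eapply cder_ccont, Hf).
set (dF := fun w => (circ_fun f' a (INR n) w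
  + - INR (S n) * circ_fun f a (INR (S n)) w)%C).
assert (HdF : forall w, cder (circ_fun f a (INR (S n))) w (dF w)).
{ intros w; eapply cder_eq; [apply (cder_circ_fun f f'); exact Hf|].
  unfold dF; replace (INR (S n) - 1) with (INR n) by (rewrite S_INR; ring).
  ring. }
assert (CdF : forall w, ccont dF w).
{ intros w; apply ccont_plus; [now apply ccont_circ_fun|].
  apply ccont_mult; [apply ccont_const|now apply ccont_circ_fun]. }
assert (H := line_int_derive _ _ x Ci 0 (2 * PI) HdF CdF).
replace (x + Ci * (2 * PI)%R)%C with (x + Ci * 0 + Ci * (2 * PI)%R)%C in H
  by ring.
rewrite circ_fun_periodic in H; unfold line_int, dF in H.
rewrite (cint_plus (fun t => circ_fun f' a (INR n) (x + Ci * t)%C)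
  (fun t => - INR (S n) * circ_fun f a (INR (S n)) (x + Ci * t))%C) in H.
- rewrite (cint_scal (fun t => circ_fun f a (INR (S n)) (x + Ci * t)%C)) in H
    by now apply conR_circ.
  fold (circ f' a (INR n) x) in H; fold (circ f a (INR (S n)) x) in H.
  assert (H' : (circ f' a (INR n) x - INR (S n) * circ f a (INR (S n)) x)%C = 0).
  { apply (f_equal (fun z => - Ci * z)%C) in H.
    match type of H with ?l = ?r => assert (E1 : l =
      ((circ f' a (INR n) x - INR (S n) * circ f a (INR (S n)) x)
       * - (Ci * Ci))%C) by ring; assert (E2 : r = 0) by ring end.
    rewrite E1, E2 in H.
    replace (- (Ci * Ci))%C with (RtoC 1) in H
      by (unfold Ci, RtoC, Cmult, Copp; simpl; f_equal; ring).
    now rewrite Cmult_1_r in H. }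
  now apply Ceq_minus.
- now apply conR_circ.
- intros t; apply ccont_mult; [apply ccont_const|].
  now apply (conR_circ f a (INR (S n)) x Cf t).
Qed.

Lemma circ_radius_indep (f : C -> C) (a : C) (n : nat) (x1 x2 : R) :
  entire f -> x1 < x2 -> circ f a (INR n) x1 = circ f a (INR n) x2.
Proof.
intros Hf Hx; assert (HPI := PI_RGT_0).
assert (HG : entire (circ_fun f a (INR n))).
{ intros w; eapply cder_ex, cder_circ_fun; intros z; now apply entire_cder. }
assert (H := goursat_rectangle _ x1 x2 0 (2 * PI) HG Hx ltac:(lra)).
unfold rect_int in H.
assert (E : line_int (circ_fun f a (INR n)) (Ci * (2 * PI)%R) 1 x1 x2
          = line_int (circ_fun f a (INR n)) (Ci * 0) 1 x1 x2).
{ unfold line_int; f_equal; apply cint_ext; intros t.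
  replace (Ci * (2 * PI)%R + 1 * t)%C with (t + Ci * (2 * PI)%R)%C by ring.
  rewrite circ_fun_periodic; f_equal; ring. }
rewrite E in H.
change (line_int (circ_fun f a (INR n)) x2 Ci 0 (2 * PI))
  with (Ci * circ f a (INR n) x2)%C in H.
change (line_int (circ_fun f a (INR n)) x1 Ci 0 (2 * PI))
  with (Ci * circ f a (INR n) x1)%C in H.
match type of H with ?l = _ => replace l with
  (Ci * (circ f a (INR n) x2 - circ f a (INR n) x1))%C in H by ring end.
apply (f_equal (Cmult (- Ci)%C)) in H.
rewrite Cmult_assoc, Cmult_0_r in H.
replace (- Ci * Ci)%C with (RtoC 1) in H
  by (apply injective_projections; simpl; ring).
rewrite Cmult_1_l in H; symmetry; now apply Ceq_minus.
Qed.

(** Integration by parts lowers the exponent to 0, where the integrand is the constant 1. *)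
Lemma circ_id (a : C) (x : R) : circ (fun z => z) a 1 x = (2 * PI)%R.
Proof.
assert (H := circ_parts (fun z => z) (fun _ => RtoC 1) a 0 x cder_id
  (ccont_const 1)).
simpl INR in H; rewrite Cmult_1_l in H; rewrite <- H.
unfold circ; rewrite (cint_ext _ (fun _ => RtoC 1)).
- rewrite cint_const, Cmult_1_r; f_equal; ring.
- intros t; unfold circ_fun.
  replace (- 0 * (x + Ci * t))%C with (RtoC 0) by ring.
  rewrite cexp_0; ring.
Qed.

Lemma circ_const (a : C) (x : R) : circ (fun _ => RtoC 1) a 1 x = 0.
Proof.
assert (H := circ_parts (fun _ => RtoC 1) (fun _ => RtoC 0) a 0 x
  (cder_const 1) (ccont_const 0)).
simpl INR in H; rewrite Cmult_1_l in H; rewrite <- H.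
unfold circ; rewrite (cint_ext _ (fun _ => RtoC 0)).
- rewrite cint_const; ring.
- intros t; unfold circ_fun; ring.
Qed.

Lemma Cmod_small_eq (z w : C) (k : R) :
  (forall eps, 0 < eps -> Cmod (z - w)%C <= k * eps) -> z = w.
Proof.
intros H; apply Ceq_minus, Cmod_eq_0.
destruct (Rle_lt_or_eq_dec _ _ (Cmod_ge_0 (z - w))) as [Hp|]; [exfalso|auto].
assert (Hk := Rabs_pos k); assert (Hk' := Rle_abs k).
assert (He : 0 < Cmod (z - w) / (2 * (1 + Rabs k)))
  by (apply Rdiv_lt_0_compat; lra).
specialize (H _ He).
assert (Heq : Cmod (z - w) / (2 * (1 + Rabs k)) * (2 * (1 + Rabs k))
  = Cmod (z - w)) by (field; lra).
nra.
Qed.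

Lemma circ_one (f : C -> C) (a : C) (x : R) : entire f ->
  circ f a 1 x = ((2 * PI)%R * C_derive f a)%C.
Proof.
intros Hf; assert (HPI := PI_RGT_0).
assert (Cf : forall z, ccont f z) by (intros; now apply entire_ccont).
set (d := C_derive f a).
(* After subtraction of the first-order Taylor polynomial at [a], whose [circ] is exactly 2 PI [d],
   it remains to see that [circ g] is small on small circles. *)
set (g := fun z => (f z + ((- f a + d * a) + - d * z))%C).
assert (Cg : forall z, ccont g z).
{ intros z; apply ccont_plus; [apply Cf|eapply cder_ccont, cder_affine]. }
assert (Cid : forall z, ccont (fun z => z) z).
{ intros z; eapply cder_ccont, cder_id. }
assert (E : forall y, circ f a 1 y = (circ g a 1 y + (2 * PI)%R * d)%C).
{ intros y.
  replace f with (fun z => ((g z + d * z) + (f a - d * a) * 1)%C) at 1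
    by (apply functional_extensionality; intros z; unfold g; ring).
  rewrite (circ_lin (fun z => g z + d * z)%C (fun _ => RtoC 1)),
    (circ_lin g (fun z => z)), circ_id, circ_const; trivial.
  - ring.
  - intros z; apply ccont_plus; trivial.
    apply ccont_mult; [apply ccont_const|apply Cid].
  - intros z; apply ccont_const. }
apply Cmod_small_eq with (k := 2 * PI); intros eps He.
destruct (entire_cder f a Hf eps He) as [del [Hdel H]].
(* The radius [exp y] is below both [exp x] and [del]; on that circle the remainder is at most
   [eps * exp y], and the factor [exp y] cancels the weight of the integrand. *)
set (y := Rmin x (ln (del / 2)) - 1).
assert (Hyx : y < x) by (assert (Hm := Rmin_l x (ln (del / 2))); unfold y; lra).
assert (Hydel : exp y < del).
{ apply Rlt_trans with (del / 2); [|lra].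
  rewrite <- (exp_ln (del / 2)) by lra; apply exp_increasing.
  assert (Hm := Rmin_r x (ln (del / 2))); unfold y; lra. }
change 1 with (INR 1); rewrite <- (circ_radius_indep f a 1 y x Hf Hyx).
change (INR 1) with 1; rewrite E.
replace (circ g a 1 y + (2 * PI)%R * d - (2 * PI)%R * d)%C
  with (circ g a 1 y) by ring.
replace (2 * PI * eps) with (2 * PI * ((eps * exp y) * exp (- (1) * y))).
- apply circ_bound; trivial; intros t.
  specialize (H (cexp (y + Ci * t))).
  rewrite Cmod_cexp in H; simpl fst in H.
  replace (y + (0 * t - 1 * 0)) with y in H by ring.
  specialize (H Hydel).
  replace (g (a + cexp (y + Ci * t))%C) with
    (f (a + cexp (y + Ci * t)) - f a - C_derive f a * cexp (y + Ci * t))%C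
    by (unfold g, d; ring).
  exact H.
- rewrite (Rmult_assoc eps), <- exp_plus.
  replace (y + - (1) * y) with 0 by ring; rewrite exp_0; ring.
Qed.

(** * Uniform estimates on discs and holomorphy of the derivative *)

Lemma continuity_2d_of_ccont (f : C -> C) (pr : C -> R) (x y : R) :
  (forall z w, Rabs (pr z - pr w) <= Cmod (z - w)%C) -> ccont f (x, y) ->
  continuity_2d_pt (fun u v => pr (f (u, v))) x y.
Proof.
intros Hpr Hf eps; destruct (Hf eps (cond_pos eps)) as [d [Hd H]].
assert (Hd2 : 0 < d / 2) by lra.
exists (mkposreal _ Hd2); simpl; intros u v Hu Hv.
eapply Rle_lt_trans; [apply Hpr|].
specialize (H ((u - x)%R + Ci * (v - y)%R)%C).
replace ((x, y) + ((u - x)%R + Ci * (v - y)%R))%C with (u, v) in H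
  by (apply injective_projections; simpl; ring).
apply H; eapply Rle_lt_trans; [apply Cmod_le_sum|]; lra.
Qed.

(** Heine's theorem for the real and imaginary parts on the square of half-side [M + 1]; the margin
    1 leaves room for [z + h]. *)
Lemma ccont_uniform (f : C -> C) (M eps : R) :
  (forall z, ccont f z) -> 0 < eps ->
  exists delta, 0 < delta /\ forall z h, Cmod z <= M -> Cmod h < delta ->
    Cmod (f (z + h) - f z)%C < eps.
Proof.
intros Hf He.
assert (He2 : 0 < eps / 2) by lra.
assert (Hre : forall z w, Rabs (fst z - fst w) <= Cmod (z - w)%C).
{ intros z w; exact (Rle_trans _ _ _ (Rmax_l _ _) (Rmax_Cmod (z - w)%C)). }
assert (Him : forall z w, Rabs (snd z - snd w) <= Cmod (z - w)%C).
{ intros z w; exact (Rle_trans _ _ _ (Rmax_r _ _) (Rmax_Cmod (z - w)%C)). }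
destruct (uniform_continuity_2d (fun u v => fst (f (u, v)))
  (- (M + 1)) (M + 1) (- (M + 1)) (M + 1)) with (eps := mkposreal _ He2)
  as [d1 H1].
{ intros x y _ _; apply (continuity_2d_of_ccont f fst); auto. }
destruct (uniform_continuity_2d (fun u v => snd (f (u, v)))
  (- (M + 1)) (M + 1) (- (M + 1)) (M + 1)) with (eps := mkposreal _ He2)
  as [d2 H2].
{ intros x y _ _; apply (continuity_2d_of_ccont f snd); auto. }
simpl in H1, H2.
exists (Rmin 1 (Rmin d1 d2)); split.
{ apply Rmin_pos; [lra|apply Rmin_pos; apply cond_pos]. }
intros z h Hz Hh.
assert (M1 := Rmin_l 1 (Rmin d1 d2)); assert (M2 := Rmin_r 1 (Rmin d1 d2)).
assert (M3 := Rmin_l d1 d2); assert (M4 := Rmin_r d1 d2).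
assert (Z1 := Rle_trans _ _ _ (Rmax_l _ _) (Rmax_Cmod z)).
assert (Z2 := Rle_trans _ _ _ (Rmax_r _ _) (Rmax_Cmod z)).
assert (K1 := Rle_trans _ _ _ (Rmax_l _ _) (Rmax_Cmod h)).
assert (K2 := Rle_trans _ _ _ (Rmax_r _ _) (Rmax_Cmod h)).
destruct z as [x y], h as [u v]; set (n := Cmod (u, v)) in *; simpl in *.
apply Rabs_le_between in Z1; apply Rabs_le_between in Z2.
assert (L1 := K1); apply Rabs_le_between in L1.
assert (L2 := K2); apply Rabs_le_between in L2.
specialize (H1 x y (x + u) (y + v)); specialize (H2 x y (x + u) (y + v)).
replace (x + u - x) with u in H1, H2 by ring.
replace (y + v - y) with v in H1, H2 by ring.
change ((x, y) + (u, v))%C with (x + u, y + v).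
specialize (H1 ltac:(lra) ltac:(lra) ltac:(lra) ltac:(lra) ltac:(lra) ltac:(lra)).
specialize (H2 ltac:(lra) ltac:(lra) ltac:(lra) ltac:(lra) ltac:(lra) ltac:(lra)).
match goal with |- Cmod ?w < _ => replace w with
  ((fst (f (x + u, y + v)%R) - fst (f (x, y)))%R
   + Ci * (snd (f (x + u, y + v)%R) - snd (f (x, y)))%R)%C
  by (apply injective_projections; simpl; ring) end.
eapply Rle_lt_trans; [apply Cmod_le_sum|]; lra.
Qed.

(** The segment from 0 to [z] is cut into [n] pieces shorter than the modulus of uniform continuity
    for 1, with [n] independent of [z]; each piece changes |f| by less than 1. *)
Lemma ccont_bounded (f : C -> C) (M : R) : (forall z, ccont f z) ->
  exists S, forall z, Cmod z <= M -> Cmod (f z) <= S.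
Proof.
intros Hf; destruct (ccont_uniform f M 1 Hf Rlt_0_1) as [d [Hd H]].
destruct (INR_unbounded (M / d)) as [n Hn].
exists (Cmod (f 0) + INR n); intros z Hz.
assert (HM : M < INR n * d).
{ apply Rmult_lt_compat_r with (r := d) in Hn; trivial.
  now replace (M / d * d) with M in Hn by (field; lra). }
assert (Hz0 := Cmod_ge_0 z).
assert (Hn0 : INR n <> 0) by (intros E; rewrite E in HM; lra).
assert (Hnp : 0 < INR n) by (assert (P := pos_INR n); lra).
assert (Hk : forall k, (k <= n)%nat ->
  Cmod (f (RtoC (INR k / INR n) * z)%C) <= Cmod (f 0) + INR k).
{ induction k as [|k IH]; intros Hkn.
  - simpl; replace (RtoC (0 / INR n) * z)%C with (RtoC 0)
      by (unfold Rdiv; rewrite Rmult_0_l; ring); lra.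
  - specialize (IH ltac:(lia)).
    specialize (H (RtoC (INR k / INR n) * z)%C (RtoC (/ INR n) * z)%C).
    rewrite !Cmod_mult, !Cmod_R, !Rabs_pos_eq in H.
    + assert (INR k <= INR n) by (apply le_INR; lia).
      assert (Hq : INR k / INR n <= 1)
        by (apply (Rdiv_le_1 (INR k)); trivial).
      assert (Hq0 : 0 <= INR k / INR n)
        by (apply Rdiv_le_0_compat; [apply pos_INR|trivial]).
      specialize (H ltac:(nra)).
      assert (Hlt : / INR n * Cmod z < d).
      { apply Rmult_lt_reg_l with (INR n); trivial.
        rewrite <- Rmult_assoc, Rinv_r by trivial; lra. }
      specialize (H Hlt).
      replace (RtoC (INR k / INR n) * z + RtoC (/ INR n) * z)%C
        with (RtoC (INR (S k) / INR n) * z)%C in H.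
      * rewrite S_INR.
        match type of H with Cmod (?u - ?v)%C < _ =>
          assert (T := Cmod_triangle (u - v) v);
          replace (u - v + v)%C with u in T by ring end.
        rewrite S_INR in *; lra.
      * rewrite S_INR; replace ((INR k + 1) / INR n)
          with (INR k / INR n + / INR n) by (field; trivial).
        rewrite RtoC_plus; ring.
    + left; now apply Rinv_0_lt_compat.
    + apply Rdiv_le_0_compat; [apply pos_INR|trivial]. }
specialize (Hk n (le_n n)).
replace (INR n / INR n) with 1 in Hk by (field; trivial).
now rewrite Cmult_1_l in Hk.
Qed.

(** By [circ_one], an increment of the derivative is an integral over the unit circle of the
    increment of [f], which is uniformly small there. *)
Lemma ccont_C_derive (f : C -> C) (a : C) : entire f -> ccont (C_derive f) a.
Proof.
intros Hf eps He; assert (HPI := PI_RGT_0).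
assert (Cf : forall z, ccont f z) by (intros; now apply entire_ccont).
destruct (ccont_uniform f (Cmod a + 1) (eps / 2) Cf ltac:(lra))
  as [d [Hd H]].
exists d; split; trivial; intros h Hh.
set (g := fun z => (f (z + h) + - (1) * f z)%C).
assert (Cfh : forall z, ccont (fun z => f (z + h)%C) z).
{ intros z; apply (ccont_comp f (fun z => z + h)%C); [apply Cf|].
  apply ccont_plus; [eapply cder_ccont, cder_id|apply ccont_const]. }
assert (Cg : forall z, ccont g z).
{ intros z; apply ccont_plus; [apply Cfh|].
  apply ccont_mult; [apply ccont_const|apply Cf]. }
assert (E : ((2 * PI)%R * (C_derive f (a + h) - C_derive f a))%C
  = circ g a 1 0).
{ unfold g; rewrite (circ_lin (fun z => f (z + h)%C) f) by trivial.
  rewrite <- circ_translate, !circ_one by trivial; ring. }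
assert (B := circ_bound g a 1 0 (eps / 2) Cg).
rewrite <- E, Cmod_mult, Cmod_R, Rabs_pos_eq in B by lra.
rewrite Rmult_0_r, exp_0, Rmult_1_r in B.
apply Rle_lt_trans with (eps / 2); [|lra].
apply Rmult_le_reg_l with (2 * PI); [lra|]; apply B; intros t; left.
unfold g.
replace (f (a + cexp (0 + Ci * t) + h) + - (1) * f (a + cexp (0 + Ci * t)))%C
  with (f (a + cexp (0 + Ci * t) + h) - f (a + cexp (0 + Ci * t)))%C by ring.
apply H; trivial.
eapply Rle_trans; [apply Cmod_triangle|].
rewrite Cmod_cexp; simpl; replace (0 + (0 * t - 1 * 0)) with 0 by ring.
rewrite exp_0; lra.
Qed.

Lemma entire_increment (f : C -> C) (z h : C) : entire f ->
  (f (z + h) - f z)%C = (h * cint (fun t => C_derive f (z + h * t)%C) 0 1)%C.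
Proof.
intros Hf.
assert (H := line_int_derive f (C_derive f) z h 0 1
  (fun z => entire_cder f z Hf) (fun z => ccont_C_derive f z Hf)).
unfold line_int in H; rewrite H.
now replace (z + h * 1)%C with (z + h)%C by ring;
  replace (z + h * 0)%C with z by ring.
Qed.

(** The remainder is [h] times the integral over [0, 1] of f'(z + h t) - f'(z), so uniform
    continuity of the derivative makes the rate independent of [z]. *)
Lemma cder_uniform (f : C -> C) (M eps : R) : entire f -> 0 < eps ->
  exists delta, 0 < delta /\ forall z h, Cmod z <= M -> Cmod h < delta ->
    Cmod (f (z + h) - f z - h * C_derive f z)%C <= eps * Cmod h.
Proof.
intros Hf He.
assert (Cf' : forall z, ccont (C_derive f) z)
  by (intros; now apply ccont_C_derive).
destruct (ccont_uniform (C_derive f) M eps Cf' He) as [d [Hd H]].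
exists d; split; trivial; intros z h Hz Hh.
rewrite entire_increment by trivial.
set (g := fun t => (C_derive f (z + h * t) + - C_derive f z)%C).
assert (Cg : conR g).
{ intros t; apply ccont_plus; [now apply conR_affine|apply ccont_const]. }
assert (E : cint g 0 1
  = (cint (fun t => C_derive f (z + h * t)%C) 0 1 - C_derive f z)%C).
{ unfold g; rewrite (cint_plus (fun t => C_derive f (z + h * t)%C)
    (fun _ => - C_derive f z)%C).
  - rewrite cint_const, Rminus_0_r; ring.
  - now apply conR_affine.
  - intros t; apply ccont_const. }
match goal with |- Cmod ?w <= _ => replace w with (h * cint g 0 1)%C
  by (rewrite E; ring) end.
rewrite Cmod_mult, Rmult_comm; apply Rmult_le_compat_r; [apply Cmod_ge_0|].
replace eps with ((1 - 0) * eps) by ring.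
apply cint_bound; trivial; [lra|]; intros t Ht; left; unfold g.
apply (H z (h * t)%C Hz); rewrite Cmod_mult, Cmod_R, Rabs_pos_eq by lra.
assert (P := Cmod_ge_0 h); nra.
Qed.

(** Differentiation under the integral sign in [circ_one]: on the unit circle the difference
    quotients of [f] converge uniformly to f' by [cder_uniform]. *)
Lemma entire_C_derive (f : C -> C) : entire f -> entire (C_derive f).
Proof.
intros Hf a; assert (HPI := PI_RGT_0).
assert (Cf : forall z, ccont f z) by (intros; now apply entire_ccont).
assert (Cf' : forall z, ccont (C_derive f) z)
  by (intros; now apply ccont_C_derive).
(* This is the value that [circ_one] would predict if f' were already known to be entire. *)
apply cder_ex with (l := (/ (2 * PI)%R * circ (C_derive f) a 1 0)%C).
intros eps He.
destruct (cder_uniform f (Cmod a + 1) eps Hf He) as [d [Hd H]].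
exists d; split; trivial; intros h Hh.
assert (Cfh : forall z, ccont (fun z => f (z + h)%C) z).
{ intros z; apply (ccont_comp f (fun z => z + h)%C); [apply Cf|].
  apply ccont_plus; [eapply cder_ccont, cder_id|apply ccont_const]. }
set (g0 := fun z => (f (z + h) + - (1) * f z)%C).
assert (Cg0 : forall z, ccont g0 z).
{ intros z; apply ccont_plus; [apply Cfh|].
  apply ccont_mult; [apply ccont_const|apply Cf]. }
set (g := fun z => (g0 z + - h * C_derive f z)%C).
assert (Cg : forall z, ccont g z).
{ intros z; apply ccont_plus; [apply Cg0|].
  apply ccont_mult; [apply ccont_const|apply Cf']. }
assert (HPIC : RtoC (2 * PI) <> 0) by (apply RtoC_inj_neq; lra).
assert (E : ((2 * PI)%R * (C_derive f (a + h) - C_derive f a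
   - / (2 * PI)%R * circ (C_derive f) a 1 0 * h))%C = circ g a 1 0).
{ unfold g, g0; rewrite (circ_lin _ (C_derive f)) by trivial.
  rewrite (circ_lin (fun z => f (z + h)%C) f) by trivial.
  rewrite <- circ_translate, (circ_one f (a + h)), (circ_one f a) by trivial.
  field.
  exact HPIC. }
assert (B := circ_bound g a 1 0 (eps * Cmod h) Cg).
rewrite <- E, Cmod_mult, Cmod_R, Rabs_pos_eq in B by lra.
rewrite Rmult_0_r, exp_0, Rmult_1_r in B.
apply Rmult_le_reg_l with (2 * PI); [lra|]; apply B; intros t.
unfold g, g0; set (w := (a + cexp (0 + Ci * t))%C).
replace (f (w + h) + - (1) * f w + - h * C_derive f w)%C
  with (f (w + h) - f w - h * C_derive f w)%C by ring.
apply H; trivial.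
eapply Rle_trans; [apply Cmod_triangle|].
rewrite Cmod_cexp; simpl; replace (0 + (0 * t - 1 * 0)) with 0 by ring.
rewrite exp_0; lra.
Qed.

Lemma D_iter_succ_r (n : nat) (f : C -> C) :
  D_iter (S n) f = D_iter n (C_derive f).
Proof. induction n as [|n IH]; simpl in *; [reflexivity|now rewrite <- IH]. Qed.

Lemma entire_D_iter (n : nat) (f : C -> C) : entire f -> entire (D_iter n f).
Proof. intros Hf; induction n; simpl; auto using entire_C_derive. Qed.

(** Each step applies the formula to f' and trades that derivative for a higher exponent by
    [circ_parts]; hence the induction for all [f] at once. *)
Lemma cauchy_formula (n : nat) (f : C -> C) (a : C) (x : R) : entire f ->
  (INR (fact (S n)) * circ f a (INR (S n)) x)%C
  = ((2 * PI)%R * D_iter (S n) f a)%C.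
Proof.
revert f; induction n as [|n IH]; intros f Hf.
- change (INR (fact 1)) with 1; change (INR 1) with 1.
  now rewrite circ_one, Cmult_1_l by trivial.
- rewrite D_iter_succ_r, <- IH by now apply entire_C_derive.
  rewrite (circ_parts f (C_derive f) a (S n) x).
  + change (fact (S (S n))) with (S (S n) * fact (S n))%nat.
    rewrite mult_INR, RtoC_mult; ring.
  + intros z; now apply entire_cder.
  + intros z; now apply ccont_C_derive.
Qed.

(** * The means [Mp] and the derivatives at the origin *)

(** [0 <= K] accounts for the default value 0 of [real] when the extended supremum is infinite, as
    for empty [E]. *)
Lemma sup_mod_le (E : C -> Prop) (g : C -> C) (K : R) : 0 <= K ->
  (forall z, E z -> Cmod (g z) <= K) -> sup_mod E g <= K.
Proof.
intros HK H; unfold sup_mod.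
destruct (Lub_Rbar_correct (fun x => exists z, E z /\ x = Cmod (g z)))
  as [_ Hl].
specialize (Hl (Finite K)).
destruct (Lub_Rbar _) as [l| |]; simpl in *; trivial.
apply Hl; intros x [z [Hz ->]]; simpl; auto.
Qed.

(** The bound [K] excludes the supremum +oo, which [real] would send to 0. *)
Lemma sup_mod_ge (E : C -> Prop) (g : C -> C) (K : R) (z : C) :
  (forall z, E z -> Cmod (g z) <= K) -> E z -> Cmod (g z) <= sup_mod E g.
Proof.
intros H Hz; unfold sup_mod.
destruct (Lub_Rbar_correct (fun x => exists z, E z /\ x = Cmod (g z)))
  as [Hu Hl].
specialize (Hl (Finite K)); specialize (Hu (Cmod (g z))).
destruct (Lub_Rbar _) as [l| |]; simpl in *.
- apply Hu; now exists z.
- exfalso; apply Hl; intros x [w [Hw ->]]; simpl; auto.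
- exfalso; apply Hu; now exists z.
Qed.

Lemma exp_le_exp (x y : R) : x <= y -> exp x <= exp y.
Proof.
intros [H| ->]; [left; now apply exp_increasing|apply Rle_refl].
Qed.

Lemma rpow_ge_0 (x y : R) : 0 <= rpow x y.
Proof.
unfold rpow; destruct (Req_EM_T x 0); [lra|left; apply exp_pos].
Qed.

Lemma rpow_pos (x y : R) : 0 < x -> rpow x y = Rpower x y.
Proof. intros Hx; unfold rpow; destruct (Req_EM_T x 0); [lra|reflexivity]. Qed.

Lemma rpow_le (x y q : R) : 0 < q -> 0 <= x <= y -> rpow x q <= rpow y q.
Proof.
intros Hq [Hx Hxy]; unfold rpow at 1; destruct (Req_EM_T x 0) as [E|E].
- apply rpow_ge_0.
- rewrite rpow_pos by lra; apply Rle_Rpower_l; lra.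
Qed.

Lemma rpow_inv_le (x y q : R) : 0 < q -> 0 <= x -> 0 < y ->
  rpow x (/ q) <= y <-> x <= rpow y q.
Proof.
intros Hq Hx Hy; rewrite (rpow_pos y) by trivial.
assert (Hyq : 0 < Rpower y q) by apply exp_pos.
assert (Hqi : 0 < / q) by now apply Rinv_0_lt_compat.
assert (E : Rpower (Rpower y q) (/ q) = y).
{ rewrite Rpower_mult, Rinv_r by lra; now apply Rpower_1. }
unfold rpow; destruct (Req_EM_T x 0) as [E0|E0]; [split; lra|].
assert (E' : Rpower (Rpower x (/ q)) q = x).
{ rewrite Rpower_mult, Rinv_l by lra; apply Rpower_1; lra. }
split; intros H.
- rewrite <- E'; apply Rle_Rpower_l; [lra|split; [apply exp_pos|trivial]].
- rewrite <- E; apply Rle_Rpower_l; lra.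
Qed.

Lemma le_one_plus_rpow (y q : R) : 1 <= q -> 0 <= y -> y <= 1 + rpow y q.
Proof.
intros Hq Hy; destruct (Rle_dec y 1) as [H|H].
- assert (P := rpow_ge_0 y q); lra.
- rewrite rpow_pos by lra; unfold Rpower.
  assert (Hl : 0 < ln y) by (rewrite <- ln_1; apply ln_increasing; lra).
  rewrite <- (exp_ln y) at 1 by lra.
  assert (ln y <= q * ln y) by nra.
  assert (exp (ln y) <= exp (q * ln y)) by now apply exp_le_exp.
  lra.
Qed.

(** The absolute value extends the power to the whole line, so that continuity at 0 is an ordinary
    two-sided statement; there eps^(1/q) serves as the radius. *)
Lemma continuous_rpow_Rabs (q x : R) : 0 < q ->
  continuous (fun x => rpow (Rabs x) q) x.
Proof.
intros Hq; destruct (Req_dec x 0) as [->|Hx].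
- apply filterlim_locally; intros eps.
  exists (mkposreal (Rpower eps (/ q)) (exp_pos _)); intros y Hy.
  change (Rabs (y - 0) < Rpower eps (/ q)) in Hy.
  change (Rabs (rpow (Rabs y) q - rpow (Rabs 0) q) < eps).
  rewrite Rminus_0_r in Hy; rewrite Rabs_R0.
  unfold rpow at 2; destruct (Req_EM_T 0 0) as [_|]; [|lra].
  rewrite Rminus_0_r, Rabs_pos_eq by apply rpow_ge_0.
  unfold rpow; destruct (Req_EM_T (Rabs y) 0) as [_|Hy0]; [apply cond_pos|].
  assert (Hy1 : 0 < Rabs y) by (assert (P := Rabs_pos y); lra).
  replace (pos eps) with (Rpower (Rpower eps (/ q)) q).
  + apply Rlt_Rpower_l; lra.
  + rewrite Rpower_mult, Rinv_l by lra; apply Rpower_1, cond_pos.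
- assert (Hx1 : 0 < Rabs x) by now apply Rabs_pos_lt.
  apply continuous_ext_loc with (fun y => Rpower (Rabs y) q).
  + exists (mkposreal _ Hx1); intros y Hy.
    change (Rabs (y - x) < Rabs x) in Hy.
    rewrite rpow_pos; trivial; apply Rabs_pos_lt; intros ->.
    rewrite Rminus_0_l, Rabs_Ropp in Hy; lra.
  + apply (continuous_comp Rabs (fun y => Rpower y q)).
    * apply continuous_Rabs.
    * apply continuity_pt_filterlim, derivable_continuous_pt.
      exists (q * Rpower (Rabs x) (q - 1)).
      now apply derivable_pt_lim_power.
Qed.

Lemma continuous_Cmod_conR (F : C -> C) (t : R) : conR F ->
  continuous (fun t => Cmod (F (RtoC t))) t.
Proof.
intros H; apply filterlim_locally; intros eps.
destruct (H t eps (cond_pos eps)) as [d [Hd Hf]].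
exists (mkposreal d Hd); intros s Hs.
change (Rabs (s - t) < d) in Hs.
change (Rabs (Cmod (F s) - Cmod (F t)) < eps).
specialize (Hf (RtoC (s - t))); rewrite Cmod_R in Hf.
replace (RtoC t + RtoC (s - t))%C with (RtoC s) in Hf
  by (rewrite RtoC_minus; ring).
eapply Rle_lt_trans; [|exact (Hf Hs)].
assert (T1 := Cmod_triangle (F s - F t) (F t)).
assert (T2 := Cmod_triangle (F t - F s) (F s)).
replace (F s - F t + F t)%C with (F s) in T1 by ring.
replace (F t - F s + F s)%C with (F t) in T2 by ring.
replace (F t - F s)%C with (- (F s - F t))%C in T2 by ring.
rewrite Cmod_opp in T2; apply Rabs_le; lra.
Qed.

Lemma continuous_rpow_conR (F : C -> C) (q t : R) : conR F -> 0 < q ->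
  continuous (fun t => rpow (Cmod (F (RtoC t))) q) t.
Proof.
intros HF Hq.
apply continuous_ext with (fun t : R => rpow (Rabs (Cmod (F t))) q).
- intros s; rewrite Rabs_pos_eq; trivial; apply Cmod_ge_0.
- apply (continuous_comp (fun t : R => Cmod (F t)) (fun x => rpow (Rabs x) q)).
  + now apply continuous_Cmod_conR.
  + now apply continuous_rpow_Rabs.
Qed.

Lemma circle_cexp (r t : R) : 0 < r ->
  (r * (cos t, sin t))%C = (0 + cexp (ln r + Ci * t))%C.
Proof.
intros Hr; rewrite cexp_plus, cexp_RtoC, exp_ln, cexp_Ci by trivial; ring.
Qed.

(** The circle as the image of a vertical line under [cexp], in the same form as in [circ_fun f 0],
    so that continuity in the angle comes from [conR_affine]. *)
Definition circle_fun (f : C -> C) (r : R) (w : C) : C :=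
  f (0 + cexp (ln r + Ci * w))%C.

Lemma conR_circle_fun (f : C -> C) (r : R) : (forall z, ccont f z) ->
  conR (circle_fun f r).
Proof.
intros Hf; apply (conR_affine (fun w => f (0 + cexp w)%C)); intros w.
apply (ccont_comp f (fun w => 0 + cexp w)%C); [apply Hf|].
apply ccont_plus; [apply ccont_const|apply ccont_cexp].
Qed.

Lemma ex_RInt_mean (f : C -> C) (q r : R) : (forall z, ccont f z) -> 0 < q ->
  0 < r -> ex_RInt (fun t => rpow (Cmod (f (r * (cos t, sin t))%C)) q) 0 (2 * PI).
Proof.
intros Hf Hq Hr.
apply ex_RInt_ext with (fun t => rpow (Cmod (circle_fun f r (RtoC t))) q).
- intros t _; unfold circle_fun; now rewrite circle_cexp.
- apply (ex_RInt_continuous (V := R_CompleteNormedModule)); intros t _.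
  apply continuous_rpow_conR; trivial; now apply conR_circle_fun.
Qed.

Lemma Cmod_circle (r t : R) : 0 < r -> Cmod (r * (cos t, sin t))%C = r.
Proof.
intros Hr; rewrite circle_cexp, Cplus_0_l, Cmod_cexp by trivial; simpl.
replace (ln r + (0 * t - 1 * 0)) with (ln r) by ring; now apply exp_ln.
Qed.

(* Up to the factor 2, [y <= 1 + y ^ q] replaces Hoelder's inequality. *)
Lemma mean_le_Mp (p : Rbar) (f : C -> C) (r B : R) :
  Rbar_le 1 p -> (forall z, ccont f z) -> 0 < r -> 0 < B -> Mp p f r <= B ->
  RInt (fun t => Cmod (circle_fun f r (RtoC t))) 0 (2 * PI) <= 4 * PI * B.
Proof.
intros Hp Hf Hr HB H; assert (HPI := PI_RGT_0).
assert (Hc := conR_circle_fun f r Hf).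
assert (Hex : ex_RInt (fun t => Cmod (circle_fun f r (RtoC t))) 0 (2 * PI)).
{ apply (ex_RInt_continuous (V := R_CompleteNormedModule)); intros t _.
  now apply continuous_Cmod_conR. }
destruct p as [q| |]; simpl in Hp; [| |contradiction].
- unfold Mp in H.
  assert (Hq : ex_RInt (fun t => rpow (Cmod (f (r * (cos t, sin t))%C)) q)
    0 (2 * PI)) by (apply ex_RInt_mean; trivial; lra).
  set (I := RInt (fun t => rpow (Cmod (f (r * (cos t, sin t))%C)) q) 0 (2 * PI)
    : R) in H.
  assert (HI : 0 <= I).
  { apply RInt_ge_0; trivial; [lra|]; intros; apply rpow_ge_0. }
  apply rpow_inv_le in H; trivial; [|lra|].
  2: { apply Rmult_le_pos; trivial; left; apply Rinv_0_lt_compat; lra. }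
  rewrite rpow_pos in H by trivial.
  assert (HBq : 0 < Rpower B q) by apply exp_pos.
  assert (HI2 : I <= 2 * PI * Rpower B q).
  { apply Rmult_le_compat_l with (r := 2 * PI) in H; [|lra].
    now replace (2 * PI * (/ (2 * PI) * I)) with I in H by (field; lra). }
  (* The inequality y <= 1 + y^q is applied to |f| / B; the two terms then contribute at most 2 PI B
     each. *)
  apply Rle_trans with (RInt (fun t => plus B (scal (B / Rpower B q)
    (rpow (Cmod (f (r * (cos t, sin t))%C)) q))) 0 (2 * PI)).
  + apply RInt_le; trivial; [lra| |].
    * apply (ex_RInt_plus (V := R_NormedModule)); [apply ex_RInt_const|].
      now apply (ex_RInt_scal (V := R_NormedModule)).
    * intros t _; unfold circle_fun; rewrite <- circle_cexp by trivial.
      set (y := Cmod (f (r * (cos t, sin t))%C)).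
      assert (Hy : 0 <= y) by apply Cmod_ge_0.
      change (y <= B + B / Rpower B q * rpow y q).
      assert (Hy1 := le_one_plus_rpow (y / B) q Hp
        (Rdiv_le_0_compat _ _ Hy HB)).
      assert (E : rpow (y / B) q = rpow y q / Rpower B q).
      { unfold rpow at 2; destruct (Req_EM_T y 0) as [->|Hy0].
        - unfold Rdiv; rewrite !Rmult_0_l; unfold rpow.
          destruct (Req_EM_T 0 0); lra.
        - rewrite rpow_pos by (apply Rdiv_lt_0_compat; lra).
          unfold Rpower; rewrite ln_div by lra.
          replace (q * (ln y - ln B)) with (q * ln y + - (q * ln B)) by ring.
          rewrite exp_plus, exp_Ropp; reflexivity. }
      rewrite E in Hy1; apply Rmult_le_compat_l with (r := B) in Hy1; [|lra].
      replace (B * (y / B)) with y in Hy1 by (field; lra).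
      replace (B + B / Rpower B q * rpow y q)
        with (B * (1 + rpow y q / Rpower B q)) by (field; lra).
      exact Hy1.
  + rewrite (RInt_plus (V := R_CompleteNormedModule)),
      (RInt_const (V := R_CompleteNormedModule)),
      (RInt_scal (V := R_CompleteNormedModule)); trivial.
    * change ((2 * PI - 0) * B + B / Rpower B q * I <= 4 * PI * B).
      assert (B / Rpower B q * I <= B / Rpower B q * (2 * PI * Rpower B q)).
      { apply Rmult_le_compat_l; trivial; apply Rdiv_le_0_compat; lra. }
      replace (B / Rpower B q * (2 * PI * Rpower B q)) with (2 * PI * B) in H0
        by (field; lra).
      lra.
    * apply ex_RInt_const.
    * now apply (ex_RInt_scal (V := R_NormedModule)).
- assert (HS : forall t : R, Cmod (circle_fun f r t) <= B).
  { intros t; eapply Rle_trans; [|exact H].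
    destruct (ccont_bounded f r Hf) as [S HS].
    unfold circle_fun; rewrite <- circle_cexp by trivial.
    apply (sup_mod_ge (fun z => Cmod z = r) f S).
    - intros z Hz; apply HS; lra.
    - now apply Cmod_circle. }
  apply Rle_trans with (RInt (fun _ => B) 0 (2 * PI)).
  + apply RInt_le; trivial; [lra|apply ex_RInt_const].
  + rewrite (RInt_const (V := R_CompleteNormedModule)).
    change ((2 * PI - 0) * B <= 4 * PI * B); nra.
Qed.

Lemma Mp_le (p : Rbar) (f : C -> C) (r B : R) :
  Rbar_le 1 p -> (forall z, ccont f z) -> 0 < r -> 0 < B ->
  (forall z, Cmod z = r -> Cmod (f z) <= B) -> Mp p f r <= B.
Proof.
intros Hp Hf Hr HB H; assert (HPI := PI_RGT_0).
destruct p as [q| |]; simpl in Hp; [| |contradiction].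
- unfold Mp.
  assert (Hex := ex_RInt_mean f q r Hf ltac:(lra) Hr).
  apply rpow_inv_le; trivial; [lra| |].
  + apply Rmult_le_pos; [left; apply Rinv_0_lt_compat; lra|].
    apply RInt_ge_0; trivial; [lra|]; intros; apply rpow_ge_0.
  + apply Rmult_le_reg_l with (2 * PI); [lra|].
    rewrite <- Rmult_assoc, Rinv_r, Rmult_1_l by lra.
    replace (2 * PI * rpow B q) with (RInt (fun _ => rpow B q) 0 (2 * PI)).
    2: { rewrite (RInt_const (V := R_CompleteNormedModule)).
         change ((2 * PI - 0) * rpow B q = 2 * PI * rpow B q); ring. }
    apply RInt_le; trivial; [lra|apply ex_RInt_const|].
    intros t _; apply rpow_le; [lra|split; [apply Cmod_ge_0|]].
    now apply H, Cmod_circle.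
- apply sup_mod_le; [lra|exact H].
Qed.

(** * Stirling's upper bound and the derivatives at the origin *)

Lemma ln_ratio_ge (x : R) : 0 < x -> 1 <= (x + / 2) * (ln (x + 1) - ln x).
Proof.
intros Hx.
(* This is ln y >= 2 (y - 1) / (y + 1) for y > 1: the difference vanishes at 1 and has derivative (y
   - 1)^2 / (y (y + 1)^2). *)
assert (H : 0 <= ln ((x + 1) / x) - 2 * ((x + 1) / x - 1) / ((x + 1) / x + 1)).
{ set (y := (x + 1) / x).
  assert (Hy : 1 < y).
  { unfold y; replace ((x + 1) / x) with (1 + / x) by (field; lra).
    assert (0 < / x) by now apply Rinv_0_lt_compat. lra. }
  destruct (MVT_gen (fun y => ln y - 2 * (y - 1) / (y + 1)) 1 y
    (fun y => / y - 4 / (y + 1) ^ 2)) as [c [Hc E]].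
  - intros u; rewrite Rmin_left, Rmax_right by lra; intros Hu.
    auto_derive; [lra|field; lra].
  - intros u; rewrite Rmin_left, Rmax_right by lra; intros Hu.
    apply derivable_continuous_pt; exists (/ u - 4 / (u + 1) ^ 2).
    apply is_derive_Reals; auto_derive; [lra|field; lra].
  - rewrite Rmin_left, Rmax_right in Hc by lra.
    rewrite ln_1 in E.
    replace (0 - 2 * (1 - 1) / (1 + 1)) with 0 in E by field.
    rewrite Rminus_0_r in E; rewrite E; apply Rmult_le_pos; [|lra].
    replace (/ c - 4 / (c + 1) ^ 2) with ((c - 1) ^ 2 / (c * (c + 1) ^ 2))
      by (field; lra).
    apply Rdiv_le_0_compat; [apply pow2_ge_0|].
    apply Rmult_lt_0_compat; [lra|apply pow_lt; lra]. }
rewrite ln_div in H by lra.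
replace (2 * ((x + 1) / x - 1) / ((x + 1) / x + 1)) with (/ (x + / 2)) in H
  by (field; lra).
apply Rle_trans with ((x + / 2) * / (x + / 2)).
- right; field; lra.
- apply Rmult_le_compat_l; lra.
Qed.

Lemma ln_fact_S (n : nat) :
  ln (INR (fact (S n))) = ln (INR (S n)) + ln (INR (fact n)).
Proof.
change (fact (S n)) with (S n * fact n)%nat; rewrite mult_INR.
apply ln_mult; [apply lt_0_INR; lia|apply INR_fact_lt_0].
Qed.

(** By [ln_ratio_ge], ln n! - (n + 1/2) ln n + n is nonincreasing; its value at n = 1 is the
    constant 1. *)
Lemma ln_fact_le (n : nat) :
  ln (INR (fact (S n)))
  <= 1 + (INR (S n) + / 2) * ln (INR (S n)) - INR (S n).
Proof.
induction n as [|n IH].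
- simpl; rewrite ln_1; lra.
- rewrite ln_fact_S.
  assert (Hn : 0 < INR (S n)) by (apply lt_0_INR; lia).
  assert (H := ln_ratio_ge _ Hn).
  rewrite (S_INR (S n)); set (x := INR (S n)) in *; nra.
Qed.

Lemma derivatives_at_0_bounded (p : Rbar) (f : C -> C) (c : R) :
  Rbar_le 1 p -> entire f -> 0 < c ->
  (forall r, 0 < r -> Mp p f r <= c * (exp r / sqrt r)) ->
  exists K, forall n, Cmod (D_iter n f 0) <= K.
Proof.
intros Hp Hf Hc H; assert (HPI := PI_RGT_0).
(* The factor 2 comes from [mean_le_Mp], and [exp 1] bounds N! N^(-N) e^N / sqrt N. Order 0 is
   separate because the radius equals the order. *)
exists (Rmax (Cmod (f 0)) (2 * c * exp 1)); intros [|n].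
{ apply Rmax_l. }
eapply Rle_trans; [|apply Rmax_r].
assert (Cf : forall z, ccont f z) by (intros; now apply entire_ccont).
set (N := INR (S n)).
assert (HN : 0 < N) by (apply lt_0_INR; lia).
assert (HsN : 0 < sqrt N) by now apply sqrt_lt_R0.
set (B := c * (exp N / sqrt N)).
assert (HB : 0 < B).
{ apply Rmult_lt_0_compat; trivial; apply Rdiv_lt_0_compat; trivial.
  apply exp_pos. }
assert (Hm := mean_le_Mp p f N B Hp Cf HN HB (H N HN)).
assert (Hcirc : Cmod (circ f 0 N (ln N)) <= exp (- N * ln N) * (4 * PI * B)).
{ eapply Rle_trans; [|apply Rmult_le_compat_l; [left; apply exp_pos|exact Hm]].
  apply (cint_bound_fun _
    (fun t => scal (exp (- N * ln N)) (Cmod (circle_fun f N (RtoC t))))).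
  - now apply conR_circ.
  - lra.
  - intros t _; unfold circ_fun; rewrite Cmod_mult, Cmod_cexp_circ.
    right; apply Rmult_comm.
  - apply (is_RInt_scal (V := R_NormedModule)).
    apply (RInt_correct (V := R_CompleteNormedModule)).
    apply (ex_RInt_continuous (V := R_CompleteNormedModule)); intros t _.
    apply continuous_Cmod_conR, conR_circle_fun, Cf. }
assert (Hcf := f_equal Cmod (cauchy_formula n f 0 (ln N) Hf)).
fold N in Hcf.
rewrite !Cmod_mult, !Cmod_R, (Rabs_pos_eq (2 * PI)), Rabs_pos_eq in Hcf
  by (try apply pos_INR; lra).
assert (Hfact := ln_fact_le n); fold N in Hfact.
assert (Hf0 := INR_fact_lt_0 (S n)).
assert (Hfe : INR (fact (S n)) * exp (- N * ln N) * exp N / sqrt N <= exp 1).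
{ replace (sqrt N) with (exp (/ 2 * ln N)).
  2: { rewrite <- (Rpower_sqrt N) by trivial; reflexivity. }
  unfold Rdiv; rewrite <- exp_Ropp, <- (exp_ln (INR (fact (S n)))) by trivial.
  rewrite <- !exp_plus; apply exp_le_exp; lra. }
apply Rmult_le_reg_l with (2 * PI); [lra|]; rewrite <- Hcf.
apply Rle_trans with (INR (fact (S n)) * (exp (- N * ln N) * (4 * PI * B))).
- now apply Rmult_le_compat_l; [lra|].
- replace (INR (fact (S n)) * (exp (- N * ln N) * (4 * PI * B))) with
    (4 * PI * c * (INR (fact (S n)) * exp (- N * ln N) * exp N / sqrt N))
    by (unfold B; field; lra).
  replace (2 * PI * (2 * c * exp 1)) with (4 * PI * c * exp 1) by ring.
  apply Rmult_le_compat_l; trivial.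
  apply Rmult_le_pos; lra.
Qed.

(** * Bounds on discs *)

Lemma is_derive_pow_fact (K s t : R) (k : nat) :
  is_derive (fun t => K * (t * s) ^ S k / INR (fact (S k))) t
    (s * (K * (t * s) ^ k / INR (fact k))).
Proof.
assert (H1 := INR_fact_lt_0 k); assert (H2 := lt_0_INR (S k) ltac:(lia)).
change (fact (S k)) with (S k * fact k)%nat; rewrite mult_INR.
auto_derive; [trivial|].
rewrite S_INR in *; simpl pred; field; split; [lra|].
change (INR (S k) <> 0); rewrite S_INR; lra.
Qed.

(** Taylor's formula as a comparison of majorants: integrating the bound for the next derivative
    from 0 to [z] reproduces K e^|z|, because e^s is its own derivative and equals 1 at 0, and moves
    the a priori bound [B] one order further. [k] counts the integrations. *)
Lemma taylor_comparison (f : C -> C) (K m : R) (B : nat -> R) : entire f ->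
  (forall n, Cmod (D_iter n f 0) <= K) ->
  (forall n z, Cmod z <= m -> Cmod (D_iter n f z) <= B n) ->
  forall k n z, Cmod z <= m ->
    Cmod (D_iter n f z)
    <= K * exp (Cmod z) + B (k + n)%nat * Cmod z ^ k / INR (fact k).
Proof.
intros Hf H0 HB; induction k as [|k IH]; intros n z Hz.
- assert (HK : 0 <= K) by (eapply Rle_trans; [apply Cmod_ge_0|apply (H0 0%nat)]).
  assert (He := exp_pos (Cmod z)).
  specialize (HB n z Hz); simpl.
  replace (B n * 1 / 1) with (B n) by field; nra.
- assert (E := entire_increment (D_iter n f) 0 z (entire_D_iter n f Hf)).
  change (C_derive (D_iter n f)) with (D_iter (S n) f) in E.
  rewrite Cplus_0_l in E.
  replace (D_iter n f z)
    with (D_iter n f 0 + z * cint (fun t => D_iter (S n) f (0 + z * t)%C) 0 1)%C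
    by (rewrite <- E; ring).
  assert (Hc : conR (fun t => D_iter (S n) f (0 + z * t)%C)).
  { apply conR_affine; intros w; apply entire_ccont, entire_D_iter, Hf. }
  set (s := Cmod z); assert (Hs : 0 <= s) by apply Cmod_ge_0.
  replace (S k + n)%nat with (k + S n)%nat by lia.
  set (b := B (k + S n)%nat).
  eapply Rle_trans; [apply Cmod_triangle|].
  (* The target becomes [K], the bound at 0, plus the increment over [0, 1] of the majorant along
     the segment. *)
  replace (K * exp s + b * s ^ S k / INR (fact (S k)))
    with (K + ((K * exp (1 * s) + b * (1 * s) ^ S k / INR (fact (S k)))
      - (K * exp (0 * s) + b * (0 * s) ^ S k / INR (fact (S k))))).
  2: { rewrite Rmult_1_l, Rmult_0_l, exp_0.
       rewrite (pow_i (S k)) by lia; unfold Rdiv; ring. }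
  apply Rplus_le_compat; [apply H0|].
  rewrite <- (cint_scal (fun t => D_iter (S n) f (0 + z * t)%C)) by trivial.
  apply (cint_bound_fun _
    (fun t => plus (s * (K * exp (t * s)))
      (s * (b * (t * s) ^ k / INR (fact k))))).
  + intros t; apply ccont_mult; [apply ccont_const|apply Hc].
  + lra.
  + intros t Ht; rewrite Cmod_mult, <- Rmult_plus_distr_l.
    fold s; apply Rmult_le_compat_l; trivial.
    assert (Ez : Cmod (0 + z * t)%C = t * s).
    { rewrite Cplus_0_l, Cmod_mult, Cmod_R, Rabs_pos_eq by lra.
      apply Rmult_comm. }
    rewrite <- Ez; apply IH; rewrite Ez; fold s in Hz; nra.
  + apply (is_RInt_derive (V := R_CompleteNormedModule) (fun t =>
      K * exp (t * s) + b * (t * s) ^ S k / INR (fact (S k)))).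
    * intros t _; apply (is_derive_plus (V := R_NormedModule));
        [|apply is_derive_pow_fact].
      auto_derive; [trivial|ring].
    * intros t _; apply (ex_derive_continuous (V := R_NormedModule)).
      change (ex_derive (fun t => s * (K * exp (t * s))
        + s * (b * (t * s) ^ k / INR (fact k))) t).
      now auto_derive.
Qed.

Lemma cauchy_estimate (f : C -> C) (a : C) (r M : R) (n : nat) : entire f ->
  0 < r -> (forall z, Cmod (z - a)%C <= r -> Cmod (f z) <= M) ->
  Cmod (D_iter n f a) <= INR (fact n) * (M / r ^ n).
Proof.
intros Hf Hr HM; assert (HPI := PI_RGT_0).
destruct n as [|n].
- simpl; replace (1 * (M / 1)) with M by field; apply HM.
  replace (a - a)%C with (RtoC 0) by ring; rewrite Cmod_0; lra.
- apply Rmult_le_reg_l with (2 * PI); [lra|].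
  assert (E := f_equal Cmod (cauchy_formula n f a (ln r) Hf)).
  rewrite !Cmod_mult, !Cmod_R, (Rabs_pos_eq (2 * PI)), Rabs_pos_eq in E
    by (try apply pos_INR; lra).
  rewrite <- E.
  replace (2 * PI * (INR (fact (S n)) * (M / r ^ S n)))
    with (INR (fact (S n)) * (2 * PI * (M / r ^ S n))) by ring.
  apply Rmult_le_compat_l; [apply pos_INR|].
  replace (M / r ^ S n)
    with (M * exp (- INR (S n) * ln r)).
  + apply circ_bound; [intros; now apply entire_ccont|].
    intros t; apply HM.
    replace (a + cexp (ln r + Ci * t) - a)%C with (cexp (ln r + Ci * t)) by ring.
    rewrite Cmod_cexp; simpl.
    replace (ln r + (0 * t - 1 * 0)) with (ln r) by ring.
    rewrite exp_ln; lra.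
  + unfold Rdiv; rewrite <- Rpower_pow, <- Rpower_Ropp by trivial.
    reflexivity.
Qed.

(** A binomial coefficient is at most 2^(j + k); the two induction hypotheses are the two terms of
    Pascal's rule. *)
Lemma fact_add_le (j k : nat) :
  (fact (j + k) <= fact j * fact k * 2 ^ (j + k))%nat.
Proof.
remember (j + k)%nat as n eqn:En; revert j k En.
induction n as [|n IH]; intros j k En.
- assert (j = 0 /\ k = 0)%nat as [-> ->] by lia; simpl; lia.
- destruct j as [|j].
  { simpl Nat.add in En; subst k.
    assert (H := Nat.pow_nonzero 2 (S n)).
    assert (fact 0 = 1)%nat by reflexivity; nia. }
  destruct k as [|k].
  { rewrite Nat.add_0_r in En; rewrite <- En.
    assert (H := Nat.pow_nonzero 2 (S n)).
    assert (fact 0 = 1)%nat by reflexivity; nia. }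
  assert (H1 := IH j (S k) ltac:(lia)); assert (H2 := IH (S j) k ltac:(lia)).
  replace (fact (S n)) with ((S j + S k) * fact n)%nat
    by (rewrite <- En; reflexivity).
  change (2 ^ S n)%nat with (2 * 2 ^ n)%nat.
  change (fact (S k)) with (S k * fact k)%nat in *.
  change (fact (S j)) with (S j * fact j)%nat in *.
  set (P := (2 ^ n)%nat) in *; clearbody P.
  set (x := fact j) in *; set (y := fact k) in *; set (w := fact n) in *.
  clearbody x y w.
  apply Nat.le_trans with
    (S j * (x * (S k * y) * P) + S k * (S j * x * y * P))%nat.
  + rewrite Nat.mul_add_distr_r; apply Nat.add_le_mono;
      now apply Nat.mul_le_mono_l.
  + apply Nat.eq_le_incl; ring.
Qed.

Lemma le_of_geometric_error (x a K : R) :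
  (forall k, x <= a + K * (/ 2) ^ k) -> x <= a.
Proof.
intros H; apply Rnot_lt_le; intros Hlt.
assert (HK := Rabs_pos K); assert (HK' := Rle_abs K).
destruct (pow_lt_1_zero (/ 2)) with (y := (x - a) / (1 + Rabs K)) as [n Hn].
- rewrite Rabs_pos_eq; lra.
- apply Rdiv_lt_0_compat; lra.
- specialize (Hn n (le_n n)); specialize (H n).
  assert (Hp : 0 < (/ 2) ^ n) by (apply pow_lt; lra).
  rewrite Rabs_pos_eq in Hn by lra.
  apply Rmult_lt_compat_l with (r := 1 + Rabs K) in Hn; [|lra].
  replace ((1 + Rabs K) * ((x - a) / (1 + Rabs K))) with (x - a) in Hn
    by (field; lra).
  nra.
Qed.

Lemma derivatives_bounded_on_disc (f : C -> C) (K m : R) : entire f -> 0 < m ->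
  (forall n, Cmod (D_iter n f 0) <= K) ->
  forall n z, Cmod z <= m -> Cmod (D_iter n f z) <= K * exp m.
Proof.
intros Hf Hm HK n z Hz.
assert (HK0 : 0 <= K) by (eapply Rle_trans; [apply Cmod_ge_0|apply (HK 0%nat)]).
(* Discs of radius [4 * m] centred in the disc of radius [m] stay inside radius [5 * m]. The factor
   4 beats the 2^(k + n) lost in [fact_add_le], so the remainder decays like 2^(-k). *)
destruct (ccont_bounded f (5 * m)) as [S HS].
{ intros; now apply entire_ccont. }
assert (HS0 : 0 <= S).
{ eapply Rle_trans; [apply Cmod_ge_0|apply (HS 0)]; rewrite Cmod_0; lra. }
assert (HB : forall n z, Cmod z <= m ->
  Cmod (D_iter n f z) <= INR (fact n) * (S / (4 * m) ^ n)).
{ intros j w Hw; apply cauchy_estimate; [trivial|lra|].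
  intros u Hu; apply HS.
  replace u with ((u - w) + w)%C by ring.
  eapply Rle_trans; [apply Cmod_triangle|lra]. }
apply le_of_geometric_error with
  (INR (fact n) * 2 ^ n * (S / (4 * m) ^ n)); intros k.
eapply Rle_trans; [apply (taylor_comparison f K m _ Hf HK HB k n z Hz)|].
assert (Hz0 := Cmod_ge_0 z).
apply Rplus_le_compat.
- apply Rmult_le_compat_l; trivial; now apply exp_le_exp.
- assert (Hfk := INR_fact_lt_0 k); assert (Hfn := INR_fact_lt_0 n).
  assert (Hf2 := le_INR _ _ (fact_add_le k n)).
  rewrite !mult_INR, pow_INR, pow_add in Hf2; simpl (INR 2) in Hf2.
  assert (Hpz : Cmod z ^ k <= m ^ k) by (apply pow_incr; lra).
  assert (P1 : 0 < m ^ k) by now apply pow_lt.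
  assert (P2 : 0 < m ^ n) by now apply pow_lt.
  assert (P3 : 0 < 4 ^ n) by (apply pow_lt; lra).
  assert (P4 : 0 < 2 ^ k) by (apply pow_lt; lra).
  assert (P6 : 0 < 2 ^ n) by (apply pow_lt; lra).
  assert (P5 : 4 ^ k = 2 ^ k * 2 ^ k).
  { rewrite <- Rpow_mult_distr; f_equal; lra. }
  rewrite !pow_add, !Rpow_mult_distr, pow_inv, P5.
  apply Rle_trans with
    ((INR (fact k) * INR (fact n) * (2 ^ k * 2 ^ n)) *
     (S / (2 ^ k * 2 ^ k * m ^ k * (4 ^ n * m ^ n))) * m ^ k / INR (fact k)).
  + apply Rmult_le_compat_r; [left; now apply Rinv_0_lt_compat|].
    assert (Q : 0 <= S / (2 ^ k * 2 ^ k * m ^ k * (4 ^ n * m ^ n))).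
    { apply Rdiv_le_0_compat; trivial; repeat apply Rmult_lt_0_compat; trivial. }
    apply Rmult_le_compat; trivial.
    * apply Rmult_le_pos; trivial; apply pos_INR.
    * now apply pow_le.
    * now apply Rmult_le_compat_r.
  + right; field; lra.
Qed.

(** * The critical growth bound excludes irregularity *)

Lemma not_irregular_of_Mp_bound (p : Rbar) (f : C -> C) (c : R) :
  Rbar_le 1 p -> entire f -> 0 < c ->
  (forall r, 0 < r -> Mp p f r <= c * (exp r / sqrt r)) -> ~ irregular f.
Proof.
intros Hp Hf Hc H (m & n & j & Hm & _ & _ & _ & Hlim).
destruct (derivatives_at_0_bounded p f c Hp Hf Hc H) as [K HK].
assert (HmR : 0 < INR m) by now apply lt_0_INR.
assert (HK0 : 0 <= K) by (eapply Rle_trans; [apply Cmod_ge_0|apply (HK 0%nat)]).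
assert (Hb : forall k, sup_mod (closed_disc m) (D_iter (j k) f)
  <= K * exp (INR m)).
{ intros k; apply sup_mod_le.
  - apply Rmult_le_pos; trivial; left; apply exp_pos.
  - intros z Hz; now apply derivatives_bounded_on_disc. }
apply is_lim_seq_spec in Hlim.
destruct (Hlim (K * exp (INR m))) as [N HN].
specialize (HN N (le_n N)); specialize (Hb N); lra.
Qed.

(** * A Stirling bound *)

Lemma ln_le_sub_1 (x : R) : 0 < x -> ln x <= x - 1.
Proof.
intros Hx; assert (H := exp_ineq1_le (ln x)); rewrite exp_ln in H by trivial.
lra.
Qed.

(* Concavity of [ln]: the mean of [ln] over [s - 1/2, s + 1/2] is at most
   [ln s]. *)
Lemma ln_midpoint (s : R) : 1 <= s ->
  (s + / 2) * ln (s + / 2) - (s - / 2) * ln (s - / 2) - 1 <= ln s.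
Proof.
intros Hs.
set (k := fun t =>
  (s + t) * ln (s + t) - (s - t) * ln (s - t) - 2 * t - 2 * t * ln s).
set (k' := fun t => ln (s + t) + ln (s - t) - 2 * ln s).
assert (Hk : forall t, 0 <= t <= / 2 -> is_derive k t (k' t)).
{ intros t Ht; unfold k, k'; auto_derive; [lra|].
  change (s + - t) with (s - t); field; lra. }
destruct (MVT_gen k 0 (/ 2) k') as [c [Hc E]].
- intros t; rewrite Rmin_left, Rmax_right by lra; intros Ht; apply Hk; lra.
- intros t; rewrite Rmin_left, Rmax_right by lra; intros Ht.
  apply derivable_continuous_pt; exists (k' t); apply is_derive_Reals, Hk; lra.
- rewrite Rmin_left, Rmax_right in Hc by lra.
  assert (Hneg : k' c <= 0).
  { unfold k'; rewrite <- ln_mult by lra.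
    assert (ln ((s + c) * (s - c)) <= ln (s * s)).
    { apply ln_le; nra. }
    rewrite (ln_mult s s) in H by lra; lra. }
  unfold k in E at 2; rewrite Rplus_0_r, Rminus_0_r in E.
  unfold k in E; nra.
Qed.

(** The left side is the integral of ln over (0, n + 1/2); each unit step is [ln_midpoint], and the
    initial piece over (0, 1/2) is negative. *)
Lemma ln_fact_ge (n : nat) :
  (INR n + / 2) * ln (INR n + / 2) - (INR n + / 2) <= ln (INR (fact n)).
Proof.
induction n as [|n IH].
- simpl; rewrite ln_1.
  assert (H := ln_le_sub_1 (0 + / 2) ltac:(lra)); nra.
- rewrite ln_fact_S, S_INR.
  assert (Hn := pos_INR n).
  assert (H := ln_midpoint (INR n + 1) ltac:(lra)).
  replace (INR n + 1 - / 2) with (INR n + / 2) in H by field; lra.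
Qed.

(** r^(n + 1/2) e^(-r) is largest at r = n + 1/2, expressed here by the tangent of ln at that point;
    the maximum is exactly what [ln_fact_ge] compares with n!. *)
Lemma pow_fact_le_exp (n : nat) (r : R) : 0 < r ->
  r ^ n / INR (fact n) * sqrt r * exp (- r) <= 1.
Proof.
intros Hr; assert (Hf := INR_fact_lt_0 n); assert (Hn := pos_INR n).
assert (Hx : 0 < INR n + / 2) by lra.
assert (H : ln r <= ln (INR n + / 2) + r / (INR n + / 2) - 1).
{ assert (H := ln_le_sub_1 (r / (INR n + / 2)) ltac:(now apply Rdiv_lt_0_compat)).
  rewrite ln_div in H by lra; lra. }
apply Rmult_le_compat_l with (r := INR n + / 2) in H; [|lra].
replace ((INR n + / 2) * (ln (INR n + / 2) + r / (INR n + / 2) - 1))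
  with ((INR n + / 2) * ln (INR n + / 2) - (INR n + / 2) + r) in H
  by (field; lra).
assert (H2 := ln_fact_ge n).
rewrite <- Rpower_pow, <- Rpower_sqrt by trivial.
unfold Rdiv; rewrite <- (exp_ln (INR (fact n))) by trivial.
rewrite <- exp_Ropp; unfold Rpower; rewrite <- !exp_plus, <- exp_0.
apply exp_le_exp; lra.
Qed.

(** * Lacunary exponential series *)

(* The [j]-th derivative of [z ^ N / N!], which is [0] when [N < j]. *)
Definition mon (N j : nat) (z : C) : C :=
  if (j <=? N)%nat then (z ^ (N - j) * RtoC (/ INR (fact (N - j))))%C else 0.

Definition rmon (N j : nat) (r : R) : R :=
  if (j <=? N)%nat then r ^ (N - j) / INR (fact (N - j)) else 0.

Lemma rmon_ge_0 (N j : nat) (r : R) : 0 <= r -> 0 <= rmon N j r.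
Proof.
intros Hr; unfold rmon; destruct (j <=? N)%nat; [|lra].
apply Rdiv_le_0_compat; [now apply pow_le|apply INR_fact_lt_0].
Qed.

Lemma rmon_le (N j : nat) (r s : R) : 0 <= r <= s -> rmon N j r <= rmon N j s.
Proof.
intros Hr; unfold rmon; destruct (j <=? N)%nat; [|lra].
apply Rmult_le_compat_r; [|now apply pow_incr].
left; apply Rinv_0_lt_compat, INR_fact_lt_0.
Qed.

Lemma mon_RtoC (N j : nat) (r : R) : mon N j r = rmon N j r.
Proof.
unfold mon, rmon; destruct (j <=? N)%nat; trivial.
unfold Rdiv; now rewrite RtoC_mult, RtoC_pow.
Qed.

Lemma Cmod_mon (N j : nat) (z : C) : Cmod (mon N j z) = rmon N j (Cmod z).
Proof.
unfold mon, rmon; destruct (j <=? N)%nat; [|apply Cmod_0].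
rewrite Cmod_mult, Cmod_pow, Cmod_R, Rabs_pos_eq; trivial.
left; apply Rinv_0_lt_compat, INR_fact_lt_0.
Qed.

(** The constant (k + 2)(k + 1) turns 1 / (k + 2)! into 1 / k!, so that after normalization the
    bound is again a monomial of the same family. *)
Lemma pow_second_order (z h : C) (k : nat) :
  Cmod ((z + h) ^ (k + 2) - z ^ (k + 2) - RtoC (INR (k + 2)) * h * z ^ (k + 1))%C
  <= INR ((k + 2) * (k + 1)) * (Cmod h ^ 2 * (Cmod z + Cmod h) ^ k).
Proof.
induction k as [|k IH].
- simpl.
  replace ((z + h) * ((z + h) * 1) - z * (z * 1) - RtoC (1 + 1) * h * (z * 1))%C
    with (h * h)%C by (rewrite RtoC_plus; ring).
  rewrite Cmod_mult; assert (H := Cmod_ge_0 h); nra.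
- replace (S k + 2)%nat with (S (k + 2)) by lia.
  replace (S k + 1)%nat with (S (k + 1)) by lia.
  replace (k + 2)%nat with (S (k + 1)) in * by lia.
  set (n := (k + 1)%nat) in *.
  assert (Hz := Cmod_ge_0 z); assert (Hh := Cmod_ge_0 h).
  assert (Hzk : Cmod (z ^ n)%C <= (Cmod z + Cmod h) ^ n).
  { rewrite Cmod_pow; apply pow_incr; lra. }
  set (D := ((z + h) ^ S n - z ^ S n - RtoC (INR (S n)) * h * z ^ n)%C) in *.
  replace ((z + h) ^ S (S n) - z ^ S (S n)
      - RtoC (INR (S (S n))) * h * z ^ S n)%C
    with ((z + h) * D + RtoC (INR (S n)) * (h * h * z ^ n))%C.
  2: { unfold D; rewrite (S_INR (S n)), RtoC_plus; simpl Cpow; ring. }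
  eapply Rle_trans; [apply Cmod_triangle|].
  rewrite !Cmod_mult, Cmod_R, (Rabs_pos_eq (INR (S n))) by apply pos_INR.
  assert (Hs := Cmod_triangle z h).
  set (rho := Cmod z + Cmod h) in *; assert (Hrho : 0 <= rho)
    by (unfold rho; lra).
  assert (HD : Cmod (z + h)%C * Cmod D
    <= rho * (INR (S n * n) * (Cmod h ^ 2 * rho ^ k))).
  { apply Rmult_le_compat; trivial; apply Cmod_ge_0. }
  assert (Hn := pos_INR (S n)).
  assert (HE : INR (S n) * (Cmod h * Cmod h * Cmod (z ^ n)%C)
    <= INR (S n) * (Cmod h * Cmod h * rho ^ n)).
  { apply Rmult_le_compat_l; trivial; apply Rmult_le_compat_l; trivial; nra. }
  eapply Rle_trans; [apply Rplus_le_compat; [exact HD|exact HE]|].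
  replace (rho * (INR (S n * n) * (Cmod h ^ 2 * rho ^ k)))
    with (INR (S n * n) * (Cmod h ^ 2 * rho ^ n))
    by (unfold n; rewrite Nat.add_1_r; simpl pow; ring).
  replace (rho ^ S k) with (rho ^ n) by (unfold n; now rewrite Nat.add_1_r).
  replace (INR (S n) * (Cmod h * Cmod h * rho ^ n))
    with (INR (S n) * (Cmod h ^ 2 * rho ^ n)) by ring.
  rewrite <- Rmult_plus_distr_r, <- plus_INR.
  apply Rmult_le_compat_r.
  + apply Rmult_le_pos; [apply pow2_ge_0|now apply pow_le].
  + apply le_INR; nia.
Qed.

(** The remainder is controlled by the monomial of order j + 2, so these bounds can be summed over a
    series. When [N] is below j + 2, the remainder is 0. *)
Lemma mon_second_order (N j : nat) (z h : C) :
  Cmod (mon N j (z + h) - mon N j z - h * mon N (S j) z)%C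
  <= Cmod h ^ 2 * rmon N (S (S j)) (Cmod z + Cmod h).
Proof.
unfold mon, rmon.
destruct (Nat.leb_spec j N) as [H0|H0]; [|
  destruct (Nat.leb_spec (S j) N); [lia|];
  destruct (Nat.leb_spec (S (S j)) N); [lia|];
  replace (0 - 0 - h * 0)%C with (RtoC 0) by ring; rewrite Cmod_0; lra].
destruct (Nat.leb_spec (S j) N) as [H1|H1].
2: { destruct (Nat.leb_spec (S (S j)) N); [lia|].
  replace (N - j)%nat with 0%nat by lia; simpl Cpow.
  match goal with |- Cmod ?w <= _ => replace w with (RtoC 0) by ring end.
  rewrite Cmod_0; lra. }
destruct (Nat.leb_spec (S (S j)) N) as [H2|H2].
2: { replace (N - j)%nat with 1%nat by lia.
  replace (N - S j)%nat with 0%nat by lia; simpl.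
  replace (RtoC (/ 1)) with (RtoC 1) by (f_equal; field).
  match goal with |- Cmod ?w <= _ => replace w with (RtoC 0) by ring end.
  rewrite Cmod_0; lra. }
set (k := (N - S (S j))%nat).
replace (N - j)%nat with (k + 2)%nat by (unfold k; lia).
replace (N - S j)%nat with (k + 1)%nat by (unfold k; lia).
assert (E1 : INR (fact (k + 1)) = INR (k + 1) * INR (fact k)).
{ rewrite <- mult_INR; f_equal; rewrite Nat.add_1_r; reflexivity. }
assert (E2 : INR (fact (k + 2)) = INR (k + 2) * (INR (k + 1) * INR (fact k))).
{ rewrite <- E1, <- mult_INR; f_equal.
  replace (k + 2)%nat with (S (k + 1)) by lia; reflexivity. }
assert (P0 := INR_fact_lt_0 k).
assert (P1 := lt_0_INR (k + 1) ltac:(lia)).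
assert (P2 := lt_0_INR (k + 2) ltac:(lia)).
assert (P3 := INR_fact_lt_0 (k + 2)).
assert (Q : RtoC (/ INR (fact (k + 1)))
  = (RtoC (INR (k + 2)) * RtoC (/ INR (fact (k + 2))))%C).
{ rewrite <- RtoC_mult; f_equal; rewrite E2, E1; field; lra. }
rewrite Q.
match goal with |- Cmod ?w <= _ => replace w with
  (((z + h) ^ (k + 2) - z ^ (k + 2) - RtoC (INR (k + 2)) * h * z ^ (k + 1))
   * RtoC (/ INR (fact (k + 2))))%C by ring end.
rewrite Cmod_mult, Cmod_R, Rabs_pos_eq
  by (left; now apply Rinv_0_lt_compat).
eapply Rle_trans.
- apply Rmult_le_compat_r; [left; now apply Rinv_0_lt_compat|].
  apply pow_second_order.
- rewrite E2, mult_INR; right; field; lra.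
Qed.

(** * Absolutely convergent complex series *)

Definition csum (u : nat -> C) : C :=
  (Series (fun n => fst (u n)), Series (fun n => snd (u n))).

Lemma ex_series_fst (u : nat -> C) (v : nat -> R) :
  (forall n, Cmod (u n) <= v n) -> ex_series v -> ex_series (fun n => fst (u n)).
Proof.
intros H Hv; apply (ex_series_le (K := R_AbsRing) (V := R_CompleteNormedModule)
  _ v); trivial; intros n.
exact (Rle_trans _ _ _ (Rmax_l _ _) (Rle_trans _ _ _ (Rmax_Cmod (u n)) (H n))).
Qed.

Lemma ex_series_snd (u : nat -> C) (v : nat -> R) :
  (forall n, Cmod (u n) <= v n) -> ex_series v -> ex_series (fun n => snd (u n)).
Proof.
intros H Hv; apply (ex_series_le (K := R_AbsRing) (V := R_CompleteNormedModule)
  _ v); trivial; intros n.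
exact (Rle_trans _ _ _ (Rmax_r _ _) (Rle_trans _ _ _ (Rmax_Cmod (u n)) (H n))).
Qed.

Lemma ex_series_scalR (c : R) (a : nat -> R) :
  ex_series a -> ex_series (fun n => c * a n).
Proof. exact (ex_series_scal (V := R_NormedModule) c a). Qed.

Lemma Series_ge_0 (a : nat -> R) :
  (forall n, 0 <= a n) -> ex_series a -> 0 <= Series a.
Proof.
intros Ha Hex; rewrite <- (Rmult_0_l (Series a)), <- Series_scal_l.
apply Series_le; trivial; intros n; rewrite Rmult_0_l; split; [lra|apply Ha].
Qed.

Lemma Series_le_ex (a b : nat -> R) : (forall n, a n <= b n) ->
  ex_series a -> ex_series b -> Series a <= Series b.
Proof.
intros Hab Ha Hb.
assert (H : 0 <= Series (fun n => b n - a n)).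
{ apply Series_ge_0; [intros n; specialize (Hab n); lra|].
  exact (ex_series_minus (V := R_NormedModule) b a Hb Ha). }
rewrite Series_minus in H by trivial; lra.
Qed.

(** Bounding coordinates separately would lose a factor; pairing with the sum w itself gives |w|^2
    <= |w| times the sum of [v]. *)
Lemma csum_bound (u : nat -> C) (v : nat -> R) :
  (forall n, Cmod (u n) <= v n) -> ex_series v -> Cmod (csum u) <= Series v.
Proof.
intros H Hv.
assert (H1 := ex_series_fst u v H Hv); assert (H2 := ex_series_snd u v H Hv).
set (w := csum u).
destruct (Rle_lt_or_eq_dec _ _ (Cmod_ge_0 w)) as [Hw|Hw].
- apply Rmult_le_reg_l with (Cmod w); trivial.
  rewrite <- Series_scal_l.
  assert (E : Cmod w * Cmod w
    = Series (fun n => fst w * fst (u n) + snd w * snd (u n))).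
  { rewrite Series_plus by now apply ex_series_scalR.
    rewrite !Series_scal_l.
    change (Series (fun n => fst (u n))) with (fst w).
    change (Series (fun n => snd (u n))) with (snd w).
    assert (H3 := Cmod2_alt w); unfold Re, Im in H3; lra. }
  rewrite E; apply Series_le_ex.
  + intros n.
    (* Cauchy-Schwarz in the plane, as [Re (Cconj w * u n) <= |w| |u n|] *)
    assert (H3 := re_le_Cmod (Cconj w * u n)%C).
    rewrite Cmod_mult, Cmod_conj in H3.
    replace (fst w * fst (u n) + snd w * snd (u n)) with (Re (Cconj w * u n)%C)
      by (unfold Re, Cconj; simpl; ring).
    eapply Rle_trans; [apply Rle_abs|]; eapply Rle_trans; [exact H3|].
    apply Rmult_le_compat_l; [lra|apply H].
  + apply (ex_series_plus (K := R_AbsRing) (V := R_NormedModule)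
      (fun n => fst w * fst (u n)) (fun n => snd w * snd (u n)));
      now apply ex_series_scalR.
  + now apply ex_series_scalR.
- rewrite <- Hw; apply Series_ge_0; trivial; intros n.
  eapply Rle_trans; [apply Cmod_ge_0|apply H].
Qed.

Lemma csum_lin (u w : nat -> C) (v v' : nat -> R) (c : C) :
  (forall n, Cmod (u n) <= v n) -> ex_series v ->
  (forall n, Cmod (w n) <= v' n) -> ex_series v' ->
  csum (fun n => u n + c * w n)%C = (csum u + c * csum w)%C.
Proof.
intros Hu Hv Hw Hv'.
assert (U1 := ex_series_fst u v Hu Hv); assert (U2 := ex_series_snd u v Hu Hv).
assert (W1 := ex_series_fst w v' Hw Hv').
assert (W2 := ex_series_snd w v' Hw Hv').
unfold csum; apply injective_projections; simpl.
- rewrite Series_plus, Series_minus, !Series_scal_l; trivial;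
    try now apply ex_series_scalR.
  apply (ex_series_minus (V := R_NormedModule)
    (fun n => fst c * fst (w n)) (fun n => snd c * snd (w n)));
    now apply ex_series_scalR.
- rewrite Series_plus, Series_plus, !Series_scal_l; trivial;
    try now apply ex_series_scalR.
  apply (ex_series_plus (V := R_NormedModule)
    (fun n => fst c * snd (w n)) (fun n => snd c * fst (w n)));
    now apply ex_series_scalR.
Qed.

Lemma sum_n_ge_term (a : nat -> R) (k n : nat) : (forall i, 0 <= a i) ->
  (k <= n)%nat -> a k <= sum_n a n.
Proof.
intros Ha Hkn; induction Hkn as [|n Hkn IH].
- destruct k as [|k]; [rewrite sum_O; lra|].
  rewrite sum_Sn; change (a (S k) <= sum_n a k + a (S k)).
  assert (H : 0 <= sum_n a k); [|lra].
  clear - Ha; induction k as [|k IH]; [rewrite sum_O; apply Ha|].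
  rewrite sum_Sn; change (0 <= sum_n a k + a (S k)).
  specialize (Ha (S k)); lra.
- rewrite sum_Sn; change (a k <= sum_n a n + a (S n)).
  specialize (Ha (S n)); lra.
Qed.

Lemma Series_le_of_sum_n (a : nat -> R) (M : R) : ex_series a ->
  (forall n, sum_n a n <= M) -> Series a <= M.
Proof.
intros [l Hl] HM; rewrite (is_series_unique _ _ Hl).
exact (is_lim_seq_le (sum_n a) (fun _ => M) l M HM Hl (is_lim_seq_const M)).
Qed.

Lemma Series_ge_term (a : nat -> R) (k : nat) : (forall i, 0 <= a i) ->
  ex_series a -> a k <= Series a.
Proof.
intros Ha [l Hl]; rewrite (is_series_unique _ _ Hl).
apply (is_lim_seq_le_loc (fun _ => a k) (sum_n a) (a k) l); trivial.
- exists k; intros n Hn; now apply sum_n_ge_term.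
- apply is_lim_seq_const.
Qed.

Lemma ex_series_geom_lt1 (q : R) : 0 <= q < 1 -> ex_series (fun n => q ^ n).
Proof.
intros Hq; exists (/ (1 - q)); apply is_series_geom; rewrite Rabs_pos_eq; lra.
Qed.

(** * Lacunary series with sparse exponents *)

Definition lac (N : nat -> nat) (j : nat) (z : C) : C :=
  csum (fun i => RtoC (INR i) * mon (N i) j z)%C.

Definition rlac (N : nat -> nat) (j : nat) (r : R) : R :=
  Series (fun i => INR i * rmon (N i) j r).

(** The orders up to [S (N i)] include the first one that annihilates all terms with index at most
    i, so what survives is a tail small on the disc of radius i + 1. The same bounds give
    convergence for every order. They start at [S i] since the weight [INR 0] removes the first
    term. *)
Definition sparse (N : nat -> nat) : Prop :=
  (forall i, (N i < N (S i))%nat) /\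
  (forall i j, (j <= S (N i))%nat ->
     INR (S i) * rmon (N (S i)) j (INR (S i)) <= (/ 4) ^ S i).

Lemma sparse_lt (N : nat -> nat) (i k : nat) : sparse N -> (i < k)%nat ->
  (N i < N k)%nat.
Proof.
intros [H _] Hik; induction Hik as [|k Hik IH]; [apply H|].
specialize (H k); lia.
Qed.

Lemma sparse_ge (N : nat -> nat) (i : nat) : sparse N -> (i <= N i)%nat.
Proof.
intros [H _]; induction i as [|i IH]; [lia|]; specialize (H i); lia.
Qed.

Lemma lac_term_ge_0 (N : nat -> nat) (j i : nat) (r : R) : 0 <= r ->
  0 <= INR i * rmon (N i) j r.
Proof. intros Hr; apply Rmult_le_pos; [apply pos_INR|now apply rmon_ge_0]. Qed.

Lemma lac_term_le (N : nat -> nat) (j i k : nat) (r : R) : sparse N ->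
  0 <= r <= INR (S k) -> (j <= S (N k))%nat -> (k <= i)%nat ->
  INR (S i) * rmon (N (S i)) j r <= (/ 4) ^ S i.
Proof.
intros HN Hr Hj Hki.
eapply Rle_trans.
- apply Rmult_le_compat_l; [apply pos_INR|].
  apply rmon_le with (s := INR (S i)); split; [lra|].
  apply Rle_trans with (INR (S k)); [lra|apply le_INR; lia].
- apply HN.
  destruct (Nat.eq_dec k i) as [->|Hne]; trivial.
  assert (H := sparse_lt N k i HN ltac:(lia)); lia.
Qed.

Lemma ex_series_lac (N : nat -> nat) (j : nat) (r : R) : sparse N -> 0 <= r ->
  ex_series (fun i => INR i * rmon (N i) j r).
Proof.
intros HN Hr; destruct (INR_unbounded r) as [k0 Hk0].
(* Beyond this index the radius exceeds [r] and, as [k <= N k], the order [j] is admissible in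
   [sparse]. *)
set (k := (k0 + j)%nat).
apply ex_series_incr_n with (S k).
apply (ex_series_le (K := R_AbsRing) (V := R_CompleteNormedModule) _
  (fun n => (/ 4) ^ n)); [|apply ex_series_geom_lt1; lra].
intros n; change (Rabs (INR (S k + n) * rmon (N (S k + n)%nat) j r) <= (/ 4) ^ n).
rewrite Rabs_pos_eq by now apply lac_term_ge_0.
apply Rle_trans with ((/ 4) ^ S (k + n)).
- apply (lac_term_le N j (k + n) k); trivial.
  + split; [trivial|]; left; apply Rlt_le_trans with (INR k0); trivial.
    apply le_INR; unfold k; lia.
  + assert (H := sparse_ge N k HN); unfold k in *; lia.
  + lia.
- replace (S (k + n)) with (S k + n)%nat by lia; rewrite pow_add.
  rewrite <- (Rmult_1_l ((/ 4) ^ n)) at 2.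
  apply Rmult_le_compat_r; [apply pow_le; lra|].
  rewrite <- (pow1 (S k)); apply pow_incr; lra.
Qed.

Lemma Cmod_lac_term (N : nat -> nat) (j i : nat) (z : C) :
  Cmod (RtoC (INR i) * mon (N i) j z)%C = INR i * rmon (N i) j (Cmod z).
Proof.
rewrite Cmod_mult, Cmod_mon, Cmod_R, Rabs_pos_eq; trivial; apply pos_INR.
Qed.

Lemma Cmod_lac (N : nat -> nat) (j : nat) (z : C) : sparse N ->
  Cmod (lac N j z) <= rlac N j (Cmod z).
Proof.
intros HN; apply csum_bound.
- intros i; rewrite Cmod_lac_term; lra.
- apply ex_series_lac; trivial; apply Cmod_ge_0.
Qed.

Lemma cder_lac (N : nat -> nat) (j : nat) (z : C) : sparse N ->
  cder (lac N j) z (lac N (S j) z).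
Proof.
intros HN eps He.
set (r := Cmod z + 1).
assert (Hz := Cmod_ge_0 z); assert (Hr : 0 <= r) by (unfold r; lra).
(* For |h| < 1 the summed second-order remainders are at most |h|^2 [s]; then |h| < eps / (1 + s)
   suffices. *)
set (s := rlac N (S (S j)) r).
assert (Hs : 0 <= s).
{ apply Series_ge_0; [intros i; now apply lac_term_ge_0|].
  now apply ex_series_lac. }
exists (Rmin 1 (eps / (1 + s))); split.
{ apply Rmin_pos; [lra|apply Rdiv_lt_0_compat; lra]. }
intros h Hh; assert (M1 := Rmin_l 1 (eps / (1 + s))).
assert (M2 := Rmin_r 1 (eps / (1 + s))); assert (Hh0 := Cmod_ge_0 h).
assert (Hex : forall j w, ex_series (fun i => INR i * rmon (N i) j (Cmod w))).
{ intros j' w; apply ex_series_lac; trivial; apply Cmod_ge_0. }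
assert (Hle : forall j w i, Cmod (RtoC (INR i) * mon (N i) j w)%C
  <= INR i * rmon (N i) j (Cmod w)).
{ intros; rewrite Cmod_lac_term; lra. }
assert (Hle2 : forall i,
  Cmod (RtoC (INR i) * mon (N i) j (z + h)
    + - (1) * (RtoC (INR i) * mon (N i) j z))%C
  <= INR i * rmon (N i) j (Cmod (z + h)) + INR i * rmon (N i) j (Cmod z)).
{ intros i; eapply Rle_trans; [apply Cmod_triangle|].
  apply Rplus_le_compat; [apply Hle|].
  rewrite Cmod_mult, Cmod_m1, Rmult_1_l; apply Hle. }
assert (E : (lac N j (z + h) - lac N j z - lac N (S j) z * h)%C =
  csum (fun i => (RtoC (INR i) * mon (N i) j (z + h)
    + - (1) * (RtoC (INR i) * mon (N i) j z))
    + - h * (RtoC (INR i) * mon (N i) (S j) z))%C).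
{ rewrite (csum_lin (fun i => RtoC (INR i) * mon (N i) j (z + h)
      + - (1) * (RtoC (INR i) * mon (N i) j z))%C
    (fun i => RtoC (INR i) * mon (N i) (S j) z)%C _ _ (- h)%C Hle2
    (ex_series_plus (V := R_NormedModule) _ _ (Hex j (z + h)%C) (Hex j z))
    (Hle (S j) z) (Hex (S j) z)).
  rewrite (csum_lin (fun i => RtoC (INR i) * mon (N i) j (z + h))%C
    (fun i => RtoC (INR i) * mon (N i) j z)%C _ _ (- (1))%C
    (Hle j (z + h)%C) (Hex j (z + h)%C) (Hle j z) (Hex j z)).
  unfold lac; ring. }
rewrite E.
apply Rle_trans with (Cmod h ^ 2 * s).
- unfold s, rlac; rewrite <- Series_scal_l; apply csum_bound.
  + intros i.
    match goal with |- Cmod ?w <= _ => replace w with (RtoC (INR i)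
      * (mon (N i) j (z + h) - mon (N i) j z - h * mon (N i) (S j) z))%C
      by ring end.
    rewrite Cmod_mult, Cmod_R, Rabs_pos_eq by apply pos_INR.
    rewrite (Rmult_comm (Cmod h ^ 2)), Rmult_assoc.
    apply Rmult_le_compat_l; [apply pos_INR|].
    eapply Rle_trans; [apply mon_second_order|].
    rewrite Rmult_comm; apply Rmult_le_compat_r; [apply pow2_ge_0|].
    apply rmon_le; unfold r; lra.
  + apply ex_series_scalR; now apply ex_series_lac.
- assert (Hhs : Cmod h * (1 + s) <= eps).
  { apply Rle_trans with (eps / (1 + s) * (1 + s)).
    - apply Rmult_le_compat_r; lra.
    - right; field; lra. }
  nra.
Qed.

Lemma entire_lac (N : nat -> nat) (j : nat) : sparse N -> entire (lac N j).
Proof. intros HN z; eapply cder_ex, cder_lac, HN. Qed.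

Lemma D_iter_lac (N : nat -> nat) (j : nat) : sparse N ->
  D_iter j (lac N 0) = lac N j.
Proof.
intros HN; induction j as [|j IH]; trivial.
change (D_iter (S j) (lac N 0)) with (C_derive (D_iter j (lac N 0))).
rewrite IH; apply functional_extensionality; intros z.
now apply cder_C_derive, cder_lac.
Qed.

Lemma rlac_le (N : nat -> nat) (j : nat) (r s : R) : sparse N -> 0 <= r <= s ->
  rlac N j r <= rlac N j s.
Proof.
intros HN Hr; apply Series_le_ex.
- intros i; apply Rmult_le_compat_l; [apply pos_INR|now apply rmon_le].
- apply ex_series_lac; trivial; lra.
- apply ex_series_lac; trivial; lra.
Qed.

(** At 0 all terms are nonnegative reals, so nothing cancels the term of index [k]. *)
Lemma lac_at_0_ge (N : nat -> nat) (k : nat) : sparse N ->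
  INR k <= Cmod (lac N (N k) 0).
Proof.
intros HN.
assert (E : fst (lac N (N k) 0) = rlac N (N k) 0).
{ apply Series_ext; intros i; rewrite mon_RtoC; simpl; ring. }
apply Rle_trans with (rlac N (N k) 0).
- apply Rle_trans with (INR k * rmon (N k) (N k) 0).
  + unfold rmon; rewrite Nat.leb_refl, Nat.sub_diag; simpl; lra.
  + apply (Series_ge_term (fun i => INR i * rmon (N i) (N k) 0)).
    * intros i; apply lac_term_ge_0; lra.
    * apply ex_series_lac; trivial; lra.
- rewrite <- E; eapply Rle_trans; [apply Rle_abs|].
  exact (Rle_trans _ _ _ (Rmax_l _ _) (Rmax_Cmod _)).
Qed.

Lemma rlac_gap_le (N : nat -> nat) (k : nat) (r : R) : sparse N ->
  0 <= r <= INR (S k) -> rlac N (S (N k)) r <= 2 * (/ 2) ^ k.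
Proof.
intros HN Hr.
(* Terms with i <= k vanish, and for i > k the bound 4^(-i) is at most 2^(-k) 2^(-i). *)
apply Rle_trans with (Series (fun i => (/ 2) ^ k * (/ 2) ^ i)).
- apply Series_le_ex.
  + intros i; assert (P : 0 < (/ 2) ^ k * (/ 2) ^ i)
      by (apply Rmult_lt_0_compat; apply pow_lt; lra).
    destruct (Nat.le_gt_cases i k) as [Hik|Hik].
    * assert (Hle : (N i <= N k)%nat).
      { destruct (Nat.eq_dec i k) as [->|Hne]; trivial.
        assert (H := sparse_lt N i k HN ltac:(lia)); lia. }
      unfold rmon; destruct (Nat.leb_spec (S (N k)) (N i)); [lia|lra].
    * destruct i as [|i]; [lia|].
      eapply Rle_trans; [apply (lac_term_le N _ i k); trivial; lia|].
      replace (/ 4) with (/ 2 * / 2) by field; rewrite Rpow_mult_distr.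
      apply Rmult_le_compat_r; [apply pow_le; lra|].
      replace (S i) with (k + (S i - k))%nat by lia; rewrite pow_add.
      rewrite <- (Rmult_1_r ((/ 2) ^ k)) at 2.
      apply Rmult_le_compat_l; [apply pow_le; lra|].
      rewrite <- (pow1 (S i - k)); apply pow_incr; lra.
  + apply ex_series_lac; trivial; lra.
  + apply ex_series_scalR, ex_series_geom_lt1; lra.
- rewrite Series_scal_l, Series_geom by (rewrite Rabs_pos_eq; lra).
  right; field.
Qed.

(** * Irregularity of the lacunary series *)

Lemma compact_set_bounded (K : C -> Prop) : compact_set K ->
  exists r, 0 <= r /\ forall z, K z -> Cmod z <= r.
Proof.
intros HK.
destruct (HK (fun V => exists n, V = fun z => Cmod z < INR n)) as [l [Hl Hcov]].
- intros V [n ->] z Hz.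
  (* Balls of the product uniform structure are squares, and the modulus is at most the sum of the
     two coordinates; hence the half. *)
  assert (Hp : 0 < (INR n - Cmod z) / 2) by lra.
  exists (mkposreal _ Hp); intros w [H1 H2]; simpl in H1, H2.
  change (Rabs (fst w - fst z) < (INR n - Cmod z) / 2) in H1.
  change (Rabs (snd w - snd z) < (INR n - Cmod z) / 2) in H2.
  assert (T := Cmod_triangle z ((fst w - fst z)%R + Ci * (snd w - snd z)%R)%C).
  assert (T2 := Cmod_le_sum (fst w - fst z) (snd w - snd z)).
  replace (z + ((fst w - fst z)%R + Ci * (snd w - snd z)%R))%C with w in T
    by (apply injective_projections; simpl; ring).
  lra.
- intros z _; destruct (INR_unbounded (Cmod z)) as [n Hn].
  exists (fun z => Cmod z < INR n); split; trivial; now exists n.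
- assert (H : exists r, 0 <= r /\
    forall V, In V l -> forall z, V z -> Cmod z <= r).
  { clear Hcov; induction l as [|V l IH].
    - exists 0; split; [lra|]; intros V [].
    - destruct IH as [r [Hr H]]; [intros W HW; apply Hl; now right|].
      destruct (Hl V (or_introl eq_refl)) as [n HV].
      exists (Rmax r (INR n)); split.
      + apply Rle_trans with r; trivial; apply Rmax_l.
      + intros W [<-|HW] z Hz.
        * apply Rle_trans with (INR n); [|apply Rmax_r].
          rewrite HV in Hz; lra.
        * apply Rle_trans with r; [now apply (H W)|apply Rmax_l]. }
  destruct H as [r [Hr H]]; exists r; split; trivial; intros z Hz.
  destruct (Hcov z Hz) as [V [HV HVz]]; now apply (H V).
Qed.

Lemma irregular_lac (N : nat -> nat) : sparse N -> irregular (lac N 0).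
Proof.
intros HN.
(* The shift to [S k] keeps the orders positive when [N 0] is 0. It also turns the gap bound 2
   (1/2)^(k + 1) into (1/2)^k. *)
exists 1%nat, (fun k => S (N (S k))), (fun k => N (S k)).
repeat split; try lia.
- intros k; assert (H := sparse_lt N (S k) (S (S k)) HN ltac:(lia)); lia.
- intros k; assert (H := sparse_ge N (S k) HN); lia.
- intros k; apply (sparse_lt N _ _ HN); lia.
- intros K HK eps He; destruct (compact_set_bounded K HK) as [r [Hr Hb]].
  destruct (INR_unbounded r) as [n1 Hn1].
  destruct (pow_lt_1_zero (/ 2)) with (y := eps) as [n2 Hn2]; trivial.
  { rewrite Rabs_pos_eq; lra. }
  exists (n1 + n2)%nat; intros k Hk z Hz.
  rewrite D_iter_lac by trivial.
  replace (lac N (S (N (S k))) z - 0)%C with (lac N (S (N (S k))) z) by ring.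
  eapply Rle_lt_trans; [apply Cmod_lac; trivial|].
  eapply Rle_lt_trans; [apply rlac_gap_le; trivial; split; [apply Cmod_ge_0|]|].
  + apply Rle_trans with r; [auto|]; apply Rle_trans with (INR n1); [lra|].
    apply le_INR; lia.
  + specialize (Hn2 k ltac:(lia)); rewrite Rabs_pos_eq in Hn2
      by (apply pow_le; lra).
    simpl; lra.
- apply is_lim_seq_spec; intros M.
  destruct (INR_unbounded M) as [n Hn]; exists n; intros k Hk.
  rewrite D_iter_lac by trivial.
  apply Rlt_le_trans with (INR (S k)).
  { apply Rlt_le_trans with (INR n); trivial; apply le_INR; lia. }
  eapply Rle_trans; [exact (lac_at_0_ge N (S k) HN)|].
  apply sup_mod_ge with (rlac N (N (S k)) 1).
  + intros z Hz; unfold closed_disc in Hz; simpl in Hz.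
    eapply Rle_trans; [apply Cmod_lac; trivial|].
    apply rlac_le; trivial; split; [apply Cmod_ge_0|trivial].
  + unfold closed_disc; rewrite Cmod_0; simpl; lra.
Qed.

(** * Choice of the exponents and growth of the series *)

Lemma rmon_eventually_small (r eps : R) (J : nat) : 0 < eps ->
  exists M, forall n j, (M <= n)%nat -> (j <= J)%nat -> rmon n j r <= eps.
Proof.
intros He; destruct (cv_speed_pow_fact r eps He) as [M HM].
exists (M + J)%nat; intros n j Hn Hj; unfold rmon.
destruct (Nat.leb_spec j n) as [H|H]; [|lra].
specialize (HM (n - j)%nat ltac:(lia)); unfold Rdist in HM.
rewrite Rminus_0_r in HM.
eapply Rle_trans; [apply Rle_abs|lra].
Qed.

(** Since r^n / n! tends to 0 on bounded sets, each exponent can be taken so large that its term is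
    negligible up to the prescribed radius [rad (S i)], even against [sqrt r] and without the help
    of [exp (- r)]. *)
Lemma exists_sparse (rad : nat -> R) : (forall i, 0 <= rad i) ->
  exists N, sparse N /\
    forall i r, 0 <= r <= rad (S i) ->
      INR (S i) * (rmon (N (S i)) 0 r * sqrt r) <= (/ 4) ^ S i.
Proof.
intros Hrad.
assert (step : forall i n, {n' | (n < n')%nat /\
  (forall j, (j <= S n)%nat ->
     INR (S i) * rmon n' j (INR (S i)) <= (/ 4) ^ S i) /\
  (forall r, 0 <= r <= rad (S i) ->
     INR (S i) * (rmon n' 0 r * sqrt r) <= (/ 4) ^ S i)}).
{ intros i n; apply constructive_indefinite_description.
  assert (Hi : 0 < INR (S i)) by (apply lt_0_INR; lia).
  assert (Hq : 0 < (/ 4) ^ S i) by (apply pow_lt; lra).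
  set (e := (/ 4) ^ S i) in *; set (x := INR (S i)) in *.
  assert (Hsq := sqrt_pos (rad (S i))).
  set (y := sqrt (rad (S i))) in *.
  destruct (rmon_eventually_small x (e / x) (S n)) as [M1 H1].
  { now apply Rdiv_lt_0_compat. }
  (* [1 + y] dominates [sqrt r] and stays positive when the radius is 0. *)
  destruct (rmon_eventually_small (rad (S i)) (e / (x * (1 + y))) 0)
    as [M2 H2].
  { apply Rdiv_lt_0_compat; trivial; apply Rmult_lt_0_compat; lra. }
  exists (S n + M1 + M2)%nat; split; [lia|split].
  - intros j Hj; specialize (H1 (S n + M1 + M2)%nat j ltac:(lia) Hj).
    apply Rmult_le_compat_l with (r := x) in H1; [|lra].
    now replace (x * (e / x)) with e in H1 by (field; lra).
  - intros r Hr; specialize (H2 (S n + M1 + M2)%nat 0%nat ltac:(lia) ltac:(lia)).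
    apply Rle_trans with (x * (e / (x * (1 + y)) * (1 + y))).
    + apply Rmult_le_compat_l; [lra|]; apply Rmult_le_compat.
      * apply rmon_ge_0; lra.
      * apply sqrt_pos.
      * eapply Rle_trans; [now apply rmon_le with (s := rad (S i))|exact H2].
      * apply Rle_trans with y; [|lra]; apply sqrt_le_1_alt; lra.
    + right; field; lra. }
exists (fix N i := match i with O => O | S i => proj1_sig (step i (N i)) end).
split; [split|]; intros i; simpl; destruct (step i _) as [n' Hn']; simpl;
  apply Hn'.
Qed.

(** Relative to e^r / sqrt r, term i is always at most i, and at most 4^(-i) while r <= [rad i]. The
    first bound is paid by [phi], the second by the spare constant 2. *)
Lemma lac_growth (N : nat -> nat) (rad : nat -> R) (phi : R -> R) : sparse N ->
  0 <= rad 0%nat ->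
  (forall i r, 0 <= r <= rad (S i) ->
     INR (S i) * (rmon (N (S i)) 0 r * sqrt r) <= (/ 4) ^ S i) ->
  (forall i r, rad i <= r -> 2 + sum_n INR i <= phi r) ->
  forall r, rad 0%nat < r -> rlac N 0 r <= phi r * (exp r / sqrt r).
Proof.
intros HN Hrad0 Hsmall Hphi r Hr.
assert (Hr0 : 0 < r) by lra.
assert (Hsq : 0 < sqrt r) by now apply sqrt_lt_R0.
set (t := fun i => INR i * (rmon (N i) 0 r * sqrt r * exp (- r))).
assert (Ht1 : forall i, t i <= INR i).
{ intros i; unfold t; rewrite <- (Rmult_1_r (INR i)) at 2.
  apply Rmult_le_compat_l; [apply pos_INR|].
  unfold rmon; simpl; rewrite Nat.sub_0_r; now apply pow_fact_le_exp. }
assert (Hexp : exp (- r) <= 1).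
{ rewrite <- exp_0; apply exp_le_exp; lra. }
assert (Ht2 : forall i, r <= rad (S i) -> t (S i) <= (/ 4) ^ S i).
{ intros i Hi; eapply Rle_trans; [|apply (Hsmall i r); lra].
  unfold t; apply Rmult_le_compat_l; [apply pos_INR|].
  rewrite <- (Rmult_1_r (rmon _ _ _ * sqrt r)) at 2.
  apply Rmult_le_compat_l; trivial.
  apply Rmult_le_pos; [apply rmon_ge_0; lra|lra]. }
(* The slack 4^(-n) absorbs the next small term. If instead [rad (S n) <= r], the whole partial sum
   is re-estimated by 1 + ... + (n + 1), so the radii may come in any order. *)
assert (Hsum : forall n, sum_n t n <= phi r - (/ 4) ^ n).
{ intros n.
  assert (Hpow : forall n, 0 < (/ 4) ^ n <= 1).
  { intros k; split; [apply pow_lt; lra|].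
    rewrite <- (pow1 k); apply pow_incr; lra. }
  assert (Hbig : forall n, rad n <= r -> sum_n t n <= phi r - 2).
  { intros k Hk; specialize (Hphi k r Hk).
    assert (H : sum_n t k <= sum_n INR k); [|lra].
    apply sum_n_m_le; exact Ht1. }
  induction n as [|n IH].
  - specialize (Hbig 0%nat ltac:(lra)); specialize (Hpow 0%nat); lra.
  - destruct (Rle_dec (rad (S n)) r) as [Hle|Hgt].
    + specialize (Hbig (S n) Hle); specialize (Hpow (S n)); lra.
    + rewrite sum_Sn; change (sum_n t n + t (S n) <= phi r - (/ 4) ^ S n).
      specialize (Ht2 n ltac:(lra)); specialize (Hpow n); simpl in *; lra. }
assert (E : rlac N 0 r = exp r / sqrt r * Series t).
{ unfold rlac; rewrite <- Series_scal_l; apply Series_ext; intros i.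
  unfold t; rewrite exp_Ropp; assert (P := exp_pos r); field; lra. }
rewrite E, Rmult_comm; apply Rmult_le_compat_r.
- apply Rdiv_le_0_compat; trivial; left; apply exp_pos.
- apply Series_le_of_sum_n.
  + apply ex_series_ext with
      (fun i => sqrt r * exp (- r) * (INR i * rmon (N i) 0 r)).
    * intros i; change (sqrt r * exp (- r) * (INR i * rmon (N i) 0 r)
        = INR i * (rmon (N i) 0 r * sqrt r * exp (- r))); ring.
    * apply ex_series_scalR, ex_series_lac; trivial; lra.
  + intros n; assert (P : 0 < (/ 4) ^ n) by (apply pow_lt; lra).
    specialize (Hsum n); lra.
Qed.

Lemma exists_irregular_slow_growth (p : Rbar) (phi : R -> R) : Rbar_le 1 p ->
  (forall r, 0 < r -> 0 < phi r) -> is_lim phi p_infty p_infty ->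
  exists f : C -> C, entire f /\ irregular f /\
    exists r0 : R, 0 < r0 /\
      forall r, r0 < r -> Mp p f r <= phi r * (exp r / sqrt r).
Proof.
intros Hp Hpos Hlim.
assert (Hrad : forall i, {R0 | 0 < R0 /\
  forall r, R0 <= r -> 2 + sum_n INR i <= phi r}).
{ intros i; apply constructive_indefinite_description.
  apply is_lim_spec in Hlim; destruct (Hlim (2 + sum_n INR i)) as [M HM].
  (* The maximum makes the radius positive; adding 1 passes from r > [M] to a closed condition. *)
  exists (Rmax M 0 + 1); assert (M1 := Rmax_l M 0); assert (M2 := Rmax_r M 0).
  split; [lra|]; intros r Hr; left; apply HM; lra. }
set (rad := fun i => proj1_sig (Hrad i)).
assert (Hrad1 : forall i, 0 < rad i)
  by (intros i; apply (proj2_sig (Hrad i))).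
destruct (exists_sparse rad) as [N [HN HNr]]; [intros i; now left|].
exists (lac N 0); split; [now apply entire_lac|].
split; [now apply irregular_lac|].
exists (rad 0%nat); split; trivial; intros r Hr.
assert (Hr0 : 0 < r) by (specialize (Hrad1 0%nat); lra).
apply Mp_le; trivial.
- intros z; now apply entire_ccont, entire_lac.
- apply Rmult_lt_0_compat; [auto|].
  apply Rdiv_lt_0_compat; [apply exp_pos|now apply sqrt_lt_R0].
- intros z Hz; eapply Rle_trans; [now apply Cmod_lac|]; rewrite Hz.
  apply (lac_growth N rad); trivial; [now left|].
  intros i s Hs; now apply (proj2_sig (Hrad i)).
Qed.

Theorem theorem7 : forall p : Rbar, Rbar_le 1 p ->
  (forall phi : R -> R,
     (forall r, 0 < r -> 0 < phi r) ->
     is_lim phi p_infty p_infty ->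
     exists f : C -> C, entire f /\ irregular f /\
       exists r0 : R, 0 < r0 /\
         forall r, r0 < r -> Mp p f r <= phi r * (exp r / sqrt r))
  /\
  ~ (exists f : C -> C, entire f /\ irregular f /\
       exists c : R, 0 < c /\
         forall r, 0 < r -> Mp p f r <= c * (exp r / sqrt r)).
Proof.
intros p Hp; split.
- intros phi; now apply exists_irregular_slow_growth.
- intros (f & Hf & Hirr & c & Hc & H).
  now apply (not_irregular_of_Mp_bound p f c).
Qed.
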